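(* Let $X$ be an infinite-dimensional real Banach space. Then $F=B_{X^*}$ is a uniform Glivenko–Cantelli class on $\Omega=B_X$ if and only if $X$ has a nontrivial type. Also, for any infinite-dimensional Banach space $X$, $F=B_{X^*}$ is not a uniform Donsker class on $\Omega=B_X$.
   Context: $B_X$ is the unit ball of $X$ and $B_{X^*}$ the unit ball of its dual, regarded as a class of functions on $B_X$. Probability measures on $\Omega=B_X$ are Borel; measurability questions for suprema are ignored in the paper (one may interpret probabilities and expectations as outer ones). A class $F$ of functions on $\Omega$ is a uniform Glivenko–Cantelli class if for every $\varepsilon>0$, $\lim_{n\to\infty}\sup_\mu \Pr\{\sup_{f\in F}|\mathbb{E}_\mu f-\frac1n\sum_{i=1}^n f(X_i)|\ge\varepsilon\}=0$, where the supremum is over all probability measures $\mu$ on $\Omega$ and $(X_i)$ are independent and distributed according to $\mu$. Type: $X$ has type $p$ if there is $C$ such that for every $n$ and all $x_1,\dots,x_n\in X$, $\mathbb{E}\|\sum_{i=1}^n\varepsilon_i x_i\|\le C(\sum_{i=1}^n\|x_i\|^p)^{1/p}$, with $(\varepsilon_i)$ independent Rademacher variables. $X$ has nontrivial type if $\sup\{p: X\text{ has type }p\}>1$. Uniform Donsker class (in the equivalent form of the Giné–Zinn characterization, which the paper uses): let $F$ be a class of functions on $\Omega$ bounded by 1. For a probability measure $P$ on $\Omega$ let $G_P$ be the centered Gaussian process indexed by $F$ with covariance $\mathbb{E}G_P(f)G_P(g)=\int fg\,dP-\int f\,dP\int g\,dP$, let $\rho_P^2(f,g)=\mathbb{E}_P(f-g)^2-(\mathbb{E}_P(f-g))^2$,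 and for $\delta>0$ put $F_\delta=\{f-g: f,g\in F,\ \rho_P(f,g)\le\delta\}$ (with $G_P(f-g)=G_P(f)-G_P(g)$). $F$ is a uniform Donsker class if and only if for every $P$, $G_P$ has a version with bounded, $\rho_P$-uniformly continuous sample paths, and for these versions $\sup_P\mathbb{E}\sup_{f\in F}|G_P(f)|<\infty$ and $\lim_{\delta\to0}\sup_P\mathbb{E}\sup_{h\in F_\delta}|G_P(h)|=0$.
   Formalization: In the Glivenko–Cantelli part the supremum is over Borel probability measures giving mass 1 to the closure of a countable set; this is all of them unless real-valued measurable cardinals exist, and with a measurable cardinal the unrestricted claim fails for some nonseparable X. *)

(* Defs.v *)
From HB Require Import structures.
From mathcomp Require Import all_boot all_order all_algebra.
From mathcomp Require Import all_classical all_reals all_analysis.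

Set Implicit Arguments.
Unset Strict Implicit.
Unset Printing Implicit Defensive.

Import Order.TTheory GRing.Theory Num.Theory.
Import numFieldNormedType.Exports.

Local Open Scope classical_set_scope.
Local Open Scope ring_scope.

Definition infinite_dimensional (R : realType) (X : normedModType R) : Prop :=
  ~ exists (n : nat) (e : 'I_n -> X),
      forall x, exists a : 'I_n -> R, x = \sum_(i < n) a i *: e i.

(* The average runs over the 2^n sign patterns: the law of n independent
   Rademacher variables is uniform on {-1, 1}^n. *)
Definition rademacher_mean (R : realType) (X : normedModType R) (n : nat)
    (x : 'I_n -> X) : R :=
  (\sum_(s : {ffun 'I_n -> bool}) `|\sum_(i < n) (-1) ^+ s i *: x i|)
    / 2 ^+ n.

Definition has_type (R : realType) (X : normedModType R) (p : R) : Prop :=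
  0 < p /\ exists C : R, forall (n : nat) (x : 'I_n -> X),
    rademacher_mean x <= C * (\sum_(i < n) `|x i| `^ p) `^ p^-1.

Definition nontrivial_type (R : realType) (X : normedModType R) : Prop :=
  (1 < ereal_sup [set p%:E | p in has_type X])%E.

Definition unit_ball (R : realType) (X : normedModType R) : set X :=
  [set x | `|x| <= 1].

Definition ball_type (R : realType) (X : normedModType R) : Type :=
  set_type (@unit_ball R X).

HB.instance Definition _ (R : realType) (X : normedModType R) :=
  Choice.copy (ball_type X) (set_type (@unit_ball R X)).

Lemma unit_ball0 (R : realType) (X : normedModType R) :
  (0 : X) \in @unit_ball R X.
Proof. by rewrite inE /unit_ball /= normr0 ler01. Qed.

HB.instance Definition _ (R : realType) (X : normedModType R) :=
  isPointed.Build (ball_type X)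
    (exist (fun x : X => x \in @unit_ball R X) 0 (@unit_ball0 R X)).

(* The unit ball with the Borel sigma-algebra of its norm topology. *)
Definition borel_ball (R : realType) (X : normedModType R) :=
  g_sigma_algebraType
    (@open (set_type (@unit_ball R X)) : set (set (ball_type X))).

Definition ball_val (R : realType) (X : normedModType R)
  (x : borel_ball X) : X := \val (x : set_type (@unit_ball R X)).

Definition dual_unit_ball (R : realType) (X : normedModType R) :
    set (borel_ball X -> R) :=
  [set f | exists phi : {linear X -> R^o},
     [/\ continuous phi, (forall x, `|x| <= 1 -> `|phi x| <= 1)
       & f = phi \o @ball_val R X]].

(* Every Borel probability measure on a separable space has this property. On a
   nonseparable complete metric space it characterizes the tight Borel
   probability measures, and ZFC without real-valued measurable cardinals proves
   that there are no others. If such cardinals exist, a Borel measure without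
   this property can be diffuse on a discrete set {e_a : a < k}; then, in a
   nonreflexive space of nontrivial type containing such e_a together with
   functionals h_b of the dual ball such that h_b(e_a) = t > 0 for a < b and
   h_b(e_a) = 0 otherwise, every h_b has mean 0 although some h_b equals t at
   all the sample points. *)
Definition separably_supported (R : realType) (X : normedModType R) :
    set (probability (borel_ball X) R) :=
  [set mu | exists D : set (set_type (@unit_ball R X)), countable D /\ mu (closure D) = 1%E].

Section empirical_processes.
Context d (T : measurableType d) (R : realType).
Implicit Types (F : set (T -> R)) (P : probability T R).

Definition iid_sample P d' (S : measurableType d') (Q : probability S R)
    (n : nat) (Xs : 'I_n -> {RV Q >-> T}) : Prop :=
  (forall i (A : set T), measurable A -> distribution Q (Xs i) A = P A) /\
  (forall A : 'I_n -> set T, (forall i, measurable (A i)) ->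
     Q (\bigcap_(i in [set: 'I_n]) (Xs i @^-1` A i)) =
     (\prod_(i < n) Q (Xs i @^-1` A i))%E).

Definition empirical_deviation F P d' (S : measurableType d')
    (Q : probability S R) (n : nat) (Xs : 'I_n -> {RV Q >-> T}) (w : S) :
    \bar R :=
  ereal_sup [set `|(\int[P]_x f x)%R - n%:R^-1 * \sum_(i < n) f (Xs i w)|%:E
            | f in F].

(* [mu_ext Q] is the outer probability. The supremum over all realizations of
   an i.i.d. sample of law P is attained by the coordinate maps of the n-fold
   product of P: pulling back a measurable cover from the product never
   increases the outer probability. *)
Definition deviation_prob F P (eps : R) (n : nat) : \bar R :=
  ereal_sup [set q | exists d' (S : measurableType d') (Q : probability S R)
      (Xs : 'I_n -> {RV Q >-> T}), iid_sample P Xs /\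
      q = mu_ext Q [set w | (eps%:E <= empirical_deviation F P Xs w)%E]].

(* [M] is the class of the probability measures under consideration. *)
Definition uniform_glivenko_cantelli (M : set (probability T R)) F : Prop :=
  forall eps : R, 0 < eps ->
    (fun n => ereal_sup [set deviation_prob F P eps n | P in M])
      @ \oo --> 0%E.

(* [normal_prob m 0] is not the Dirac mass at m, hence the case distinction. *)
Definition normal_law d' (S : measurableType d') (Q : probability S R)
    (Y : S -> R) (m s : R) : Prop :=
  forall A : set R, measurable A ->
    Q (Y @^-1` A) = if s == 0 then \d_m A else normal_prob m s A.

(* The values of [G] outside [F] play no role. *)
Definition centered_gaussian_process F (K : (T -> R) -> (T -> R) -> R)
    d' (S : measurableType d') (Q : probability S R)
    (G : (T -> R) -> {RV Q >-> R}) : Prop :=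
  [/\ forall (n : nat) (f : 'I_n -> T -> R) (a : 'I_n -> R),
        (forall i, F (f i)) ->
        exists m s : R, normal_law Q (fun w => \sum_(i < n) a i * G (f i) w) m s,
      forall f, F f -> ('E_Q[G f] = 0)%E
    & forall f g, F f -> F g -> covariance Q (G f) (G g) = (K f g)%:E].

Definition bridge_cov P (f g : T -> R) : R :=
  \int[P]_x (f x * g x) - (\int[P]_x f x) * (\int[P]_x g x).

Definition rho P (f g : T -> R) : R :=
  Num.sqrt (\int[P]_x ((f x - g x) ^+ 2) - (\int[P]_x (f x - g x)) ^+ 2).

Definition bounded_paths F d' (S : measurableType d') (Q : probability S R)
    (G : (T -> R) -> {RV Q >-> R}) : Prop :=
  forall w, exists B : R, forall f, F f -> `|G f w| <= B.

Definition unif_continuous_paths F P d' (S : measurableType d')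
    (Q : probability S R) (G : (T -> R) -> {RV Q >-> R}) : Prop :=
  forall w (e : R), 0 < e -> exists2 delta : R, 0 < delta &
    forall f g, F f -> F g -> rho P f g < delta -> `|G f w - G g w| < e.

Definition regular_version F P d' (S : measurableType d') (Q : probability S R)
    (G : (T -> R) -> {RV Q >-> R}) : Prop :=
  [/\ centered_gaussian_process F (bridge_cov P) G,
      bounded_paths F G & unif_continuous_paths F P G].

Definition F_delta F P (delta : R) : set ((T -> R) * (T -> R)) :=
  [set h | [/\ F h.1, F h.2 & rho P h.1 h.2 <= delta]].

(* For regular versions the suprema inside these two expectations are suprema
   over countable rho_P-dense subsets, so they are measurable and their means do
   not depend on the version: the outer suprema only serve to name the common
   value. *)
Definition mean_sup F P : \bar R :=
  ereal_sup [set m | exists d' (S : measurableType d') (Q : probability S R)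
      (G : (T -> R) -> {RV Q >-> R}), regular_version F P G /\
      m = (\int[Q]_w ereal_sup [set `|G f w|%:E | f in F])%E].

Definition mean_modulus F P (delta : R) : \bar R :=
  ereal_sup [set m | exists d' (S : measurableType d') (Q : probability S R)
      (G : (T -> R) -> {RV Q >-> R}), regular_version F P G /\
      m = (\int[Q]_w
             ereal_sup [set `|G h.1 w - G h.2 w|%:E | h in F_delta F P delta])%E].

(* For classes of measurable functions bounded by 1. *)
Definition uniform_donsker F : Prop :=
  [/\ forall P, exists d' (S : measurableType d') (Q : probability S R)
        (G : (T -> R) -> {RV Q >-> R}), regular_version F P G,
      (ereal_sup [set mean_sup F P | P in [set: probability T R]] < +oo)%E
    & (fun delta : R =>
         ereal_sup [set mean_modulus F P delta | P in [set: probability T R]])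
        @ 0^'+ --> 0%E].

End empirical_processes.

(* Main.v *)
(* Glivenko-Cantelli from type.  A separably supported law is approximated by
   one with finitely many values y_j, up to a set of small mass.  For a finitely
   supported law, symmetrization bounds the mean of |E Y - (1/n) sum Y_i| by
   (2/n) E |sum eps_i Y_i| = O(n^(1/p - 1)), and Markov's inequality concludes.

   Type from Glivenko-Cantelli (Pisier).  If some 4m vectors of the unit ball
   have all their signed sums of norm almost 4m, functionals norming these sums
   take values near 1 on any m of the vectors and near -1 on the others, so that
   the deviation is large for every sample of size m of the uniform law.
   Otherwise E |sum eps_i x_i|^2 <= theta n sum |x_i|^2 with theta < 1 for
   n = 4m; this inequality tensorizes, hence E |sum_(i < N) eps_i x_i| =
   O(N^alpha) with alpha < 1 in the unit ball, and a dyadic decomposition of the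
   norms gives a type p > 1.

   Failure of the Donsker property.  For every k there are x_1, ..., x_k in the
   unit ball with |sum a_i x_i| >= |a|_2 / 2 (dual Dvoretzky-Rogers lemma).  By
   Hahn-Banach, for every sign vector s some f_s in the dual ball takes the values
   s_i / (2 sqrt k) on them.  For the uniform law P on these points, f_s is within
   1 / (2 sqrt k) of 0 for rho_P, while max_s |G_P(f_s) - G_P(0)| is a.s. the sum
   of k terms |G_P(h_i)| of mean of order 1/k, where h_i(x_j) = delta_ij / (2 sqrt k). *)

Require Import Defs.
From HB Require Import structures.
From mathcomp Require Import all_boot all_order all_fingroup all_algebra.
From mathcomp Require Import all_classical all_reals all_analysis.
From mathcomp Require Import measurable_realfun.
From mathcomp Require Import ring lra zify.
Import numFieldNormedType.Exports.
Set Implicit Arguments.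
Unset Strict Implicit.
Unset Printing Implicit Defensive.
Import Order.TTheory GRing.Theory Num.Theory.
Local Open Scope classical_set_scope.
Local Open Scope ring_scope.

(** * Hahn-Banach extension *)

(** Suprema over the dual ball are not known to be measurable, which shapes both halves. For
    Glivenko-Cantelli the deviation event is covered by finitely many measurable cells of samples,
    on each of which one number bounds the deviation for all functionals at once. For Donsker the
    integral of the supremum is only bounded from below, by that of a measurable function.

    Means over signs or over finitely supported samples are finite sums computed by recursion on the
    number of variables, so that induction takes the place of Fubini's theorem.

    No compactness enters the dual Dvoretzky-Rogers lemma: an ellipsoid optimal up to a fixed factor
    is enough, since a suitable perturbation would otherwise gain more than this factor.

    The parameters of a normal law are never identified with its moments. Crude inequalities between
    them suffice, and the constants 96 and 28 come from there. *)

Section HahnBanach.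
Context {R : realType} {X : normedModType R}.

(** A partial functional is encoded as a linear subspace of [X * R^o] below the norm, so that plain
    unions bound chains. It is single-valued automatically: otherwise a multiple of some
    [(0, r - s)] would exceed the norm of 0. *)
Definition dominated_graph (G : set (X * R^o)) : Prop :=
  [/\ G (0, 0), forall a u v, G u -> G v -> G (a *: u + v)
    & forall u, G u -> u.2 <= `|u.1|].

Lemma dominated_graphZ G a u : dominated_graph G -> G u -> G (a *: u).
Proof. by move=> [G0 GD _] Gu; rewrite -[_ *: _]addr0; apply: GD. Qed.

(** The value at [x0] must lie between all u.2 - |u.1 - x0| and all |v.1 + x0| - v.2. The triangle
    inequality orders the two families, and [c] is the supremum of the first. Homogeneity reduces
    the coefficient [t] to 1 or -1. *)
Lemma dominated_graph_extend G x0 : dominated_graph G ->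
  exists c : R, dominated_graph
    [set w | exists2 u, G u & exists t : R, w = u + t *: ((x0, c) : X * R^o)].
Proof.
move=> gG; have [G00 GD Gle] := gG.
have key u v : G u -> G v -> u.2 - `|u.1 - x0| <= `|v.1 + x0| - v.2.
  move=> Gu Gv; have := Gle _ (GD 1 _ _ Gu Gv).
  rewrite scale1r /= => h.
  have : `|u.1 + v.1| <= `|u.1 - x0| + `|v.1 + x0|.
    by apply: le_trans (ler_normD _ _); rewrite addrACA addNr addr0.
  by lra.
pose S := [set u.2 - `|u.1 - x0| | u in G] : set R.
have S0 : S !=set0 by exists (0 - `|0 - x0|); exists (0, 0).
have ubS v : G v -> ubound S (`|v.1 + x0| - v.2).
  by move=> Gv _ [u Gu <-]; exact: key.
pose c := sup S; exists c.
have hS : has_sup S by split => //; exists (`|0 + x0| - 0); exact: (ubS (0, 0)).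
have c1 u : G u -> u.2 - `|u.1 - x0| <= c.
  by move=> Gu; apply: sup_ubound; [exact: hS.2 | exists u].
have c2 v : G v -> c <= `|v.1 + x0| - v.2.
  by move=> Gv; apply: ge_sup => //; exact: ubS.
split.
- by exists (0, 0) => //; exists 0; rewrite scale0r addr0.
- move=> a _ _ [u Gu [t ->]] [v Gv [s ->]].
  exists (a *: u + v); first exact: GD.
  by exists (a * t + s); rewrite scalerDr scalerA addrACA -scalerDl.
move=> _ [u Gu [t ->]] /=.
rewrite -![_ *: c]/(t * c).
have [t0|t0|->] := ltgtP t 0; last by rewrite mul0r scale0r !addr0; exact: Gle.
- have Gv : G ((- t^-1) *: u) by exact: dominated_graphZ.
  have tn : 0 < - t^-1 by rewrite oppr_gt0 invr_lt0.
  have h := c1 _ Gv; rewrite /= -![_ *: u.2]/(_ * u.2) in h.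
  have e : (- t^-1) *: u.1 - x0 = (- t^-1) *: (u.1 + t *: x0).
    by rewrite scalerDr scalerA mulNr mulVf ?lt_eqF// scaleN1r.
  rewrite e normrZ (gtr0_norm tn) -mulrBr in h.
  have nt : 0 <= - t by rewrite oppr_ge0 ltW.
  have := ler_wpM2l nt h.
  by rewrite mulrA mulrNN mulfV ?lt_eqF// mul1r; lra.
- have Gv : G (t^-1 *: u) by exact: dominated_graphZ.
  have tn : 0 < t^-1 by rewrite invr_gt0.
  have h := c2 _ Gv; rewrite /= -![_ *: u.2]/(_ * u.2) in h.
  have e : t^-1 *: u.1 + x0 = t^-1 *: (u.1 + t *: x0).
    by rewrite scalerDr scalerA mulVf ?gt_eqF// scale1r.
  rewrite e normrZ (gtr0_norm tn) -mulrBr in h.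
  have := ler_wpM2l (ltW t0) h.
  by rewrite mulrA mulfV ?gt_eqF// mul1r; lra.
Qed.

Lemma hahn_banach G : dominated_graph G ->
  exists phi : {linear X -> R^o},
    (forall x, `|phi x| <= `|x|) /\ forall u, G u -> phi u.1 = u.2.
Proof.
move=> gG.
(* The property concerns the union of [G] and [A], so that it also holds for the empty union of the
   empty chain. *)
have [A [gA Amax]] : exists A, dominated_graph (G `|` A) /\
    forall B, A `<` B -> ~ dominated_graph (G `|` B).
  apply: (@Zorn_bigcup _ (fun A => dominated_graph (G `|` A))) => F FP Ftot.
  have [G00 GD Gle] := gG.
  split; first by left.
  - move=> a u v [Gu|[A FA Au]] [Gv|[B FB Bv]].
    + by left; exact: GD.
    + have [_ /(_ a u v) h _] := FP _ FB.
      by case: h => [||?|?]; [left|right|left|right; exists B].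
    + have [_ /(_ a u v) h _] := FP _ FA.
      by case: h => [||?|?]; [right|left|left|right; exists A].
    + have [AB|BA] := Ftot _ _ FA FB.
      * have [_ /(_ a u v) h _] := FP _ FB.
        by case: h => [||?|?]; [right; exact: AB|right|left|right; exists B].
      * have [_ /(_ a u v) h _] := FP _ FA.
        by case: h => [||?|?]; [right|right; exact: BA|left|right; exists A].
  - move=> u [Gu|[A FA Au]]; first exact: Gle.
    by have [_ _ h] := FP _ FA; apply: h; right.
set M := G `|` A in gA; have [M0 MD Mle] := gA.
have Mfun x r s : M (x, r) -> M (x, s) -> r = s.
  move=> Mr Ms; have h a : a * (r - s) <= 0.
    have := Mle _ (dominated_graphZ a gA (MD (-1) _ _ Ms Mr)).
    rewrite /= (scaleN1r x) addNr scaler0 normr0.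
    by rewrite -[_ *: _]/(a * (-1 * s + r)) mulN1r addrC.
  have := h 1; have := h (-1); lra.
have Mtot x : exists r, M (x, r).
  have [c gN] := dominated_graph_extend x gA.
  set N := [set _ | _] in gN.
  have MN : M `<=` N.
    by move=> u Mu; exists u => //; exists 0; rewrite scale0r addr0.
  have NM : N `<=` M.
    have AN : A `<=` N by move=> u Au; apply: MN; right.
    apply: contrapT => nNM; apply: (Amax N).
      split=> // NA; apply: nNM => u /NA ?; by right.
    suff -> : G `|` N = N by [].
    by apply/seteqP; split=> u; [case=> // ?; apply: MN; left|right].
  exists c; apply: NM; exists (0, 0) => //; exists 1.
  by rewrite add0r scale1r.
have /choice[f fM] := Mtot.
have flin : linear (f : X -> R^o).
  move=> a x y; apply: (@Mfun (a *: x + y)); first exact: fM.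
  exact: (MD a _ _ (fM x) (fM y)).
pose f' : X -> R^o := f.
pose L := GRing.isLinear.Build _ _ _ _ f' flin.
pose phi : {linear X -> R^o} := HB.pack f' L.
exists phi; split; last first.
  by move=> [x r] Gx; apply: (@Mfun x); [exact: fM|left].
move=> x; rewrite ler_norml; apply/andP; split; last exact: (Mle _ (fM x)).
have := Mle _ (dominated_graphZ (-1) gA (fM x)).
by rewrite /= normrZ normrN1 mul1r -[_ *: _]/(-1 * f x) mulN1r lerNl.
Qed.

Lemma contraction_continuous (phi : {linear X -> R^o}) :
  (forall x, `|phi x| <= `|x|) -> continuous phi.
Proof.
move=> h; apply: bounded_linear_continuous; apply/linear_boundedP.
by exists 1; split; [exact: num_real|move=> M /ltW M1 x];
  apply: le_trans (h x) _; rewrite ler_peMl.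
Qed.

(** Helly's criterion for prescribed values: the pairs [(x i, b i)] span a graph, dominated by
    hypothesis, whether or not the [x i] are independent. *)
Lemma helly n (x : 'I_n -> X) (b : 'I_n -> R) :
  (forall a : 'I_n -> R, \sum_(i < n) a i * b i <= `|\sum_(i < n) a i *: x i|) ->
  exists phi : {linear X -> R^o}, [/\ continuous phi,
    forall y, `|phi y| <= `|y| & forall i, phi (x i) = b i].
Proof.
move=> h.
pose G : set (X * R^o) := [set u | exists a : 'I_n -> R,
   u = (\sum_(i < n) a i *: x i, \sum_(i < n) a i * b i)].
have gG : dominated_graph G.
  split.
  - exists (fun=> 0); congr (_, _); first by rewrite big1 // => i _; rewrite scale0r.
    by rewrite big1 // => i _; rewrite mul0r.
  - move=> c _ _ [a ->] [a' ->]; exists (fun i => c * a i + a' i).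
    congr (_, _); rewrite /= scaler_sumr -big_split /=; apply: eq_bigr => i _.
      by rewrite scalerDl scalerA.
    by rewrite -[_ *: _]/(c * (a i * b i)) mulrDl mulrA.
  - by move=> _ [a ->] /=.
have [phi [ph1 ph2]] := hahn_banach gG.
exists phi; split => //; first exact: contraction_continuous.
move=> i; have := ph2 (x i, b i); apply; exists (fun j => (j == i)%:R).
congr (_, _).
  by rewrite (bigD1 i) //= eqxx scale1r big1 ?addr0 // => j /negbTE ->; rewrite scale0r.
by rewrite (bigD1 i) //= eqxx mul1r big1 ?addr0 // => j /negbTE ->; rewrite mul0r.
Qed.

End HahnBanach.

(** * The dual Dvoretzky-Rogers lemma *)

Section Determinants.

(** Sylvester's identity: one block matrix is factored into block triangular ones in two ways. *)
Lemma det_1BmulC (F : fieldType) m n (A : 'M[F]_(m, n)) (B : 'M[F]_(n, m)) :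
  \det (1%:M - A *m B) = \det (1%:M - B *m A).
Proof.
have e1 : block_mx 1%:M A B 1%:M =
    block_mx 1%:M 0 B 1%:M *m block_mx 1%:M A 0 (1%:M - B *m A).
  by rewrite mulmx_block ?(mul1mx, mulmx1, mul0mx, mulmx0) ?addr0 addrC subrK.
have e2 : block_mx 1%:M A B 1%:M =
    block_mx (1%:M - A *m B) A 0 1%:M *m block_mx 1%:M 0 B 1%:M.
  by rewrite mulmx_block ?(mul1mx, mulmx1, mul0mx, mulmx0) ?add0r subrK.
have := congr1 determinant e1; rewrite e2 !det_mulmx.
by rewrite !det_ublock !det_lblock !det1 !mulr1 !mul1r.
Qed.

Lemma prodr_1B_ge (R : realFieldType) (I : finType) (f : I -> R) :
  (forall i, 0 <= f i <= 1) -> 1 - \sum_i f i <= \prod_i (1 - f i) <= 1.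
Proof.
move=> f01.
have : (1 - \sum_i f i <= \prod_i (1 - f i)) && (0 <= \prod_i (1 - f i) <= 1).
  elim/big_rec2 : _ => [|i s p _ /and3P[h1 h2 h3]].
    by rewrite subr0 lexx ler01.
  have /andP[g0 g1] := f01 i; apply/and3P; split; nra.
by case/and3P => -> _ ->.
Qed.

(** In the Leibniz expansion the identity contributes at least 1 - t k. Any other permutation moves
    some i and also s i, hence has two off-diagonal factors and size at most t^2. There are fewer
    than k! of these, in total at most k! t^2 <= t. *)
Lemma det_1BZ_ge (R : realFieldType) k (G : 'M[R]_k) (t : R) :
  0 <= t -> t * k`!%:R <= 1 ->
  (forall i, 0 <= G i i <= 1) -> (forall i j, `|G i j| <= 1) ->
  1 - t * k.+1%:R <= \det (1%:M - t *: G).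
Proof.
move=> t0 tk Gd Ge.
have t1 : t <= 1.
  apply: le_trans tk; rewrite ler_peMr// ler1n; exact: fact_gt0.
rewrite /determinant (bigD1 (1%g : 'S_k)) //= odd_perm1 expr0 mul1r.
have dG i : (1%:M - t *: G) i i = 1 - t * G i i by rewrite !mxE eqxx.
have oG i j : i != j -> `|(1%:M - t *: G) i j| <= t.
  move=> /negbTE ij; rewrite !mxE ij sub0r normrN normrM (ger0_norm t0).
  by rewrite ler_piMr.
have aG i j : `|(1%:M - t *: G) i j| <= 1.
  have [<-|/oG h] := eqVneq i j; last exact: le_trans h t1.
  rewrite dG; have /andP[g0 g1] := Gd i; rewrite ger0_norm; nra.
have h1 : 1 - t * k%:R <= \prod_i (1%:M - t *: G) i ((1%g : 'S_k) i).
  under eq_bigr do rewrite perm1 dG.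
  have H := @prodr_1B_ge R _ (fun i => t * G i i).
  have {H} /H/andP[h _] : forall i, 0 <= t * G i i <= 1.
    by move=> i; have /andP[g0 g1] := Gd i; apply/andP; split; nra.
  apply: le_trans h; rewrite -mulr_sumr lerB// ler_wpM2l//.
  apply: (@le_trans _ _ (\sum_(i < k) (1 : R))); last first.
    by rewrite sumr_const card_ord.
  by apply: ler_sum => i _; have /andP[] := Gd i.
have h2 : `|\sum_(s : 'S_k | s != 1%g)
    (-1) ^+ s * \prod_i (1%:M - t *: G) i (s i)| <= k`!%:R * t ^+ 2.
  apply: le_trans (ler_norm_sum _ _ _) _.
  apply: (@le_trans _ _ (\sum_(s : 'S_k | s != 1%g) t ^+ 2)); last first.
    rewrite sumr_const mulr_natl ler_wpMn2l ?exprn_ge0//.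
    by rewrite -(card_Sn k) max_card.
  apply: ler_sum => s s1; rewrite normrM normrX normrN1 expr1n mul1r normr_prod.
  have [i si] : exists i, s i != i.
    apply/existsP; apply: contraR s1; rewrite negb_exists => /forallP h.
    by apply/eqP/permP => i; rewrite perm1; apply/eqP/negPn/h.
  have ssi : s (s i) != s i by rewrite (inj_eq perm_inj).
  rewrite (bigD1 i) //= (bigD1 (s i)) //= mulrA expr2.
  apply: (@le_trans _ _ (t * t * 1)); last by rewrite mulr1.
  apply: ler_pM.
  - by rewrite mulr_ge0.
  - by apply: prodr_ge0 => *.
  - by apply: ler_pM => //; apply: oG; rewrite eq_sym.
  - by apply: prodr_ile1 => j _; rewrite normr_ge0 aG.
have h3 : k`!%:R * t ^+ 2 <= t.
  by rewrite expr2 mulrA mulrC ler_piMr// mulrC.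
move: h2; rewrite ler_norml => /andP[h2 _].
rewrite -natr1 mulrDr mulr1 opprD addrA; apply: lerD => //.
by apply: le_trans h2; rewrite lerN2.
Qed.

End Determinants.

Lemma scale_regE (R : ringType) (a : R) (b : R^o) : a *: b = a * b.
Proof. by []. Qed.

Section QuadraticForms.
Context {R : realType} {N : nat}.
Implicit Types (S : 'M[R]_N) (u v w : 'cV[R]_N).

Definition bform S u v : R := (u^T *m S *m v) 0 0.

Lemma bformDZr S u a v w : bform S u (a *: v + w) = a * bform S u v + bform S u w.
Proof. by rewrite /bform mulmxDr -scalemxAr !mxE. Qed.

Lemma bformC S u v : S^T = S -> bform S u v = bform S v u.
Proof.
move=> St; rewrite /bform -[in LHS](trmxK (_ *m v)) [LHS]mxE.
by rewrite !trmx_mul trmxK St mulmxA.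
Qed.

Lemma bformDZl S u a v w : S^T = S ->
  bform S (a *: v + w) u = a * bform S v u + bform S w u.
Proof. by move=> St; rewrite bformC// bformDZr !(@bformC S u). Qed.

Lemma bform0r S u : bform S u 0 = 0.
Proof. by rewrite /bform mulmx0 mxE. Qed.

Lemma bformZr S u a v : bform S u (a *: v) = a * bform S u v.
Proof. by rewrite -[_ *: v]addr0 bformDZr bform0r addr0. Qed.

Lemma bformZl S u a v : S^T = S -> bform S (a *: v) u = a * bform S v u.
Proof. by move=> St; rewrite bformC// bformZr bformC. Qed.

Lemma bform_sumr S u (I : Type) (r : seq I) (v : I -> 'cV[R]_N) :
  bform S u (\sum_(i <- r) v i) = \sum_(i <- r) bform S u (v i).
Proof.
by elim/big_rec2 : _ => [|i s w _ <-]; [exact: bform0r|rewrite -{1}[v i]scale1r bformDZr mul1r].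
Qed.

Lemma bform_suml S u (I : Type) (r : seq I) (v : I -> 'cV[R]_N) : S^T = S ->
  bform S (\sum_(i <- r) v i) u = \sum_(i <- r) bform S (v i) u.
Proof.
by move=> St; rewrite bformC// bform_sumr; apply: eq_bigr => i _; rewrite bformC.
Qed.

Lemma bform_delta S i j : bform S (delta_mx i 0) (delta_mx j 0) = S i j.
Proof. by rewrite /bform trmx_delta -rowE -colE !mxE. Qed.

Lemma bform_CS S u v : S^T = S -> (forall v, 0 <= bform S v v) ->
  bform S u u <= 1 -> bform S u v ^+ 2 <= bform S v v.
Proof.
move=> St S0 u1; set b := bform S u v.
have := S0 (- b *: u + v).
rewrite bformDZr !bformDZl// (@bformC S v u)// -/b; have := S0 u; nra.
Qed.

End QuadraticForms.

(** * Ellipsoids of almost maximal determinant and almost orthogonal vectors *)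

Section DvoretzkyRogers.
Context {R : realType} {X : normedModType R}.

Definition lincomb N (e : 'I_N -> X) (v : 'cV[R]_N) : X := \sum_i v i 0 *: e i.

Lemma lincombZ N (e : 'I_N -> X) a v : lincomb e (a *: v) = a *: lincomb e v.
Proof. by rewrite scaler_sumr; apply: eq_bigr => i _; rewrite mxE scalerA. Qed.

Lemma lincomb_sum N (e : 'I_N -> X) (I : Type) (r : seq I) v :
  lincomb e (\sum_(i <- r) v i) = \sum_(i <- r) lincomb e (v i).
Proof.
rewrite /lincomb exchange_big; apply: eq_bigr => i _ /=.
by rewrite summxE scaler_suml.
Qed.

(** The ellipsoid S(v, v) <= 1 contains the unit ball of the norm of [lincomb e v]. It is its polar
    that is inscribed, in the dual ball; for definite S the volume of the polar is proportional to
    the square root of det S. *)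
Definition inscribed N (e : 'I_N -> X) (S : 'M[R]_N) : Prop :=
  [/\ S^T = S, forall v, 0 <= bform S v v
    & forall v, bform S v v <= `|lincomb e v| ^+ 2].

Lemma inscribed_det_le N (e : 'I_N -> X) : exists K : R,
  forall S, inscribed e S -> \det S <= K.
Proof.
pose K : R := \sum_i `|e i| ^+ 2.
exists (N`!%:R * K ^+ N) => S [St S0 Sle].
have Sd i : 0 <= S i i <= K.
  rewrite -bform_delta S0 (le_trans (Sle _))// /K (bigD1 i)//=.
  have -> : lincomb e (delta_mx i 0) = e i.
    rewrite /lincomb (bigD1 i)//= big1 ?addr0 ?mxE ?eqxx ?scale1r// => j ji.
    by rewrite mxE (negbTE ji) scale0r.
  by rewrite lerDl sumr_ge0// => j _; rewrite exprn_ge0.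
have Se i j : `|S i j| <= K.
  have := S0 (1 *: delta_mx i 0 + delta_mx j 0).
  have := S0 ((-1) *: delta_mx i 0 + delta_mx j 0).
  rewrite !bformDZr !bformDZl// !bform_delta.
  have -> : S j i = S i j by rewrite -[in LHS]St mxE.
  have /andP[_ h1] := Sd i; have /andP[_ h2] := Sd j => h3 h4.
  by rewrite ler_norml; apply/andP; split; lra.
apply: le_trans (ler_norm _) _; rewrite /determinant.
apply: le_trans (ler_norm_sum _ _ _) _.
apply: (@le_trans _ _ (\sum_(s : {perm 'I_N}) K ^+ N)).
  apply: ler_sum => s _; rewrite normrM normrX normrN1 expr1n mul1r normr_prod.
  rewrite -[X in K ^+ X](card_ord N) -prodr_const.
  by apply: ler_prod => i _; rewrite normr_ge0 Se.
by rewrite sumr_const -(card_Sn N) mulr_natl.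
Qed.

(** Small enough for two purposes: t k! <= 1, as [det_1BZ_ge] requires, and y = t (k + 1) <= 1/4,
    which is what (1 + 2 y) (1 - y) >= 1 + y / 2 requires. *)
Definition step_size k : R := (4 * k.+1`!%:R)^-1.

Section Improve.
Variables (N k : nat) (e : 'I_N -> X) (S : 'M[R]_N) (x : 'I_k -> 'cV[R]_N).
Hypotheses (Sin : inscribed e S) (S_gt0 : 0 < \det S)
  (x1 : forall i, bform S (x i) (x i) <= 1) (Nk : (2 * k.+1 <= N)%N).

Let t : R := step_size k.
Let a : R := 2 * k.+1%:R / N%:R.
Let s : R := 1 + t * a.
Let U : 'M[R]_(N, k) := \matrix_(i, j) x j i 0.
(* The form S, dilated except along the x_j: its determinant exceeds that of S
   because the trace N a of the dilation exceeds the number k of the x_j. *)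
Let S' : 'M[R]_N := s *: S - t *: (S *m U *m (U^T *m S)).

Let N0 : 0 < N%:R :> R.
Proof. by rewrite ltr0n; apply: leq_trans Nk. Qed.

Let t0 : 0 < t.
Proof. by rewrite /t /step_size invr_gt0 mulr_gt0// ltr0n fact_gt0. Qed.

Let tk1 : t * k.+1%:R <= 4^-1.
Proof.
rewrite /t /step_size invfM -mulrA ler_piMr// mulrC ler_pdivrMr ?ltr0n ?fact_gt0// mul1r.
by rewrite ler_nat; elim: k => // n IH; rewrite factS leq_pmulr// fact_gt0.
Qed.

Let a01 : 0 < a <= 1.
Proof.
rewrite /a divr_gt0 ?mulr_gt0//= ler_pdivrMr// mul1r -natrM ler_nat//.
Qed.

Let t1 : t <= 4^-1.
Proof. by apply: le_trans tk1; rewrite ler_peMr ?ler1n// ltW. Qed.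

Let bformS' v : bform S' v v = s * bform S v v - t * \sum_j bform S (x j) v ^+ 2.
Proof.
have [St _ _] := Sin.
have -> : bform S' v v =
    s * bform S v v - t * ((v^T *m S *m U) *m (U^T *m (S *m v))) 0 0.
  by rewrite /bform /S' mulmxBr mulmxBl -!scalemxAr -!scalemxAl !mulmxA !mxE.
congr (_ - _ * _); rewrite mxE; apply: eq_bigr => j _.
have colU : col j U = x j by apply/colP => i; rewrite !mxE.
have e2 : (U^T *m (S *m v)) j 0 = bform S (x j) v.
  rewrite /bform -mulmxA !mxE; apply: eq_bigr => i _; congr (_ * _).
  by rewrite !mxE.
have e1 : (v^T *m S *m U) 0 j = bform S (x j) v.
  rewrite (bformC _ _ St) /bform !mxE; apply: eq_bigr => i _; congr (_ * _).
  by rewrite !mxE.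
by rewrite e1 e2 expr2.
Qed.

(** Once S is factored out, Sylvester's identity leaves s^N times the k by k determinant of 1 - (t /
    s) G, where G is the Gram matrix of the x_j. Bernoulli gives s^N >= 1 + 2 t (k + 1), and
    [det_1BZ_ge] gives at least 1 - t (k + 1) for the other factor. *)
Let detS' : (1 + t * k.+1%:R / 2) * \det S <= \det S'.
Proof.
have [St S0 _] := Sin.
have /andP[a0 a1] := a01.
have s0 : 0 < s by rewrite /s addr_gt0// mulr_gt0.
have s1 : 1 <= s by rewrite /s lerDl mulr_ge0// ltW.
pose t' := t / s.
have t'0 : 0 <= t' by rewrite /t' divr_ge0// ltW.
have t't : t' <= t by rewrite /t' ler_pdivrMr// ler_peMr// ltW.
have -> : S' = s *: (S *m (1%:M - (t' *: U) *m (U^T *m S))).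
  rewrite mulmxBr mulmx1 scalerBr -scalemxAl -scalemxAr scalerA.
  by rewrite mulrCA mulfV ?gt_eqF// mulr1 /S' !mulmxA.
rewrite detZ det_mulmx det_1BmulC.
pose G := U^T *m S *m U.
have -> : U^T *m S *m (t' *: U) = t' *: G by rewrite -scalemxAr.
have GE i j : G i j = bform S (x i) (x j).
  rewrite /bform !mxE; apply: eq_bigr => l _; congr (_ * _); rewrite !mxE //.
  by apply: eq_bigr => m _; rewrite !mxE.
have Gd i : 0 <= G i i <= 1 by rewrite GE S0 x1.
have Ge i j : `|G i j| <= 1.
  have h := bform_CS (x j) St S0 (x1 i).
  rewrite GE -(@ler_pXn2r _ 2) ?nnegrE// expr1n real_normK ?num_real//.
  exact: le_trans h (x1 j).
have kf : t' * k`!%:R <= 1.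
  apply: (@le_trans _ _ (t * k.+1`!%:R)).
    by apply: ler_pM => //; rewrite ler_nat factS leq_pmull.
  by rewrite /t /step_size invfM -mulrA mulVf ?mulr1 ?gt_eqF ?ltr0n ?fact_gt0//; lra.
have hd := det_1BZ_ge t'0 kf Gd Ge.
have hs : 1 + 2 * (t * k.+1%:R) <= s ^+ N.
  have -> : 2 * (t * k.+1%:R) = (t * a) *+ N.
    by rewrite -mulr_natr /a; field; rewrite gt_eqF.
  have : 0 <= t * a by rewrite mulr_ge0// ltW.
  rewrite /s; elim: N => [|n IH h]; first by rewrite mulr0n addr0 expr0.
  have := IH h; set z := t * a in h * => h2.
  have hz : 0 <= z *+ n by rewrite mulrn_wge0.
  by rewrite exprS mulrS; nra.
rewrite mulrCA mulrC ler_pM2l//.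
have h4 : 1 - t * k.+1%:R <= \det (1%:M - t' *: G).
  by apply: le_trans hd; rewrite lerB// ler_wpM2r.
have tk0 : 0 <= t * k.+1%:R by rewrite mulr_ge0// ltW.
move: hs h4 tk0 tk1; set y := t * _ => hs h4 y0 y1.
have : (1 + 2 * y) * (1 - y) <= s ^+ N * \det (1%:M - t' *: G).
  by apply: ler_pM => //; lra.
by apply: le_trans; nra.
Qed.

(** The determinant of [S'] is too large for an inscribed form, and [S'] is nonnegative, so |v|^2 <
    S'(v, v) for some v, while S(v, v) <= |v|^2. Hence the gain t a S(v, v) outweighs the loss t
    sum_j S(x_j, v)^2, and v is almost orthogonal to the x_j; moreover s <= 2 gives S(v, v) >= |v|^2
    / 2. *)
Lemma inscribed_improve :
  (forall S', inscribed e S' ->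
    \det S' < (1 + step_size k * k.+1%:R / 2) * \det S) ->
  exists y, [/\ `|lincomb e y| <= 1, 2^-1 <= bform S y y &
    \sum_j bform S (x j) y ^+ 2 <= 2 * k.+1%:R / N%:R].
Proof.
move=> Smax; have [St S0 Sle] := Sin.
have /andP[a0 a1] := a01.
have nS' : ~ inscribed e S' by move=> /Smax; rewrite ltNge detS'.
have S't : S'^T = S'.
  by rewrite /S' linearB /= !linearZ /= !trmx_mul !trmxK St !mulmxA.
have S'0 v : 0 <= bform S' v v.
  rewrite bformS'; have h : \sum_j bform S (x j) v ^+ 2 <= k%:R * bform S v v.
    rewrite mulr_natl -[X in _ *+ X](card_ord k) -sumr_const.
    by apply: ler_sum => j _; exact: bform_CS.
  have := ler_wpM2l (ltW t0) h; rewrite mulrA.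
  have tk : t * k%:R <= 1.
    have := tk1; rewrite -natr1 mulrDr mulr1; have := t0; lra.
  have := ler_wpM2r (S0 v) tk.
  have : 0 <= t * a * bform S v v by rewrite !mulr_ge0// ltW.
  by rewrite /s; lra.
have [v hv] : exists v, `|lincomb e v| ^+ 2 < bform S' v v.
  apply: contrapT => h; apply: nS'; split => // v.
  by rewrite leNgt; apply/negP => hv; apply: h; exists v.
rewrite bformS' in hv; have := Sle v.
set q := bform S v v in hv *; set n := `|_| in hv *; set m := \sum_j _ in hv * => qn.
have m0 : 0 <= m by apply: sumr_ge0 => j _; rewrite sqr_ge0.
have n0 : 0 <= n by exact: normr_ge0.
have q0 : 0 <= q by exact: S0.
have n_gt0 : 0 < n.
  rewrite lt0r n0 andbT; apply/negP => /eqP nE; move: hv qn; rewrite nE expr0n /=.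
  move=> hv q_le; have q0' : q = 0 by apply/eqP; rewrite eq_le q_le q0.
  by move: hv; rewrite q0' mulr0; have := t0; nra.
have h1 : m < a * q.
  have : t * m < t * (a * q) by move: hv; rewrite /s; lra.
  by rewrite ltr_pM2l.
have tm0 : 0 <= t * m by rewrite mulr_ge0// ltW.
have ta : t * a <= 1 by have := t0; have := t1; nra.
exists (n^-1 *: v); split.
- by rewrite lincombZ normrZ gtr0_norm ?invr_gt0// mulVf ?gt_eqF.
- rewrite bformZr bformZl// mulrA -expr2 -/q mulrC exprVn.
  by rewrite ler_pdivlMr ?exprn_gt0//; rewrite /s in hv; nra.
- under eq_bigr do rewrite bformZr exprMn.
  rewrite -mulr_sumr -/m exprVn mulrC ler_pdivrMr ?exprn_gt0// -/a.
  by apply: le_trans (ltW h1) _; rewrite ler_pM2l.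
Qed.

End Improve.


(** The matrix of the f_i(e_j) is triangular with unit diagonal, a quantitative form of independence
    that yields a first inscribed form of positive determinant. *)
Lemma triangular_system (infX : infinite_dimensional X) n :
  exists (e : nat -> X) (f : nat -> {linear X -> R^o}),
  [/\ forall i, (i < n)%N -> forall y, `|f i y| <= `|y|,
      forall i, (i < n)%N -> f i (e i) = 1
    & forall i j, (i < j < n)%N -> f i (e j) = 0].
Proof.
elim: n => [|n [e [f [f1 fe fe0]]]].
  by exists (fun=> 0), (fun=> \0); split=> // i j; rewrite ltn0 andbF.
have [x xNspan] : exists x, forall a : nat -> R, x != \sum_(i < n) a i *: e i.
  apply: contrapT => h; apply: infX; exists n, (fun i => e i) => x.
  apply: contrapT => h'; apply: h; exists x => a; apply/eqP => xa.
  by apply: h'; exists (fun i => a i).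
(* Forward elimination: the coefficient of [e m] is the value of [f m] at the current remainder.
   Subtracting this multiple keeps the earlier zeros, as [f i] vanishes at [e m] for i < m. *)
have /(_ n (leqnn n))[a ha] : forall m, (m <= n)%N -> exists a : nat -> R,
    forall i, (i < m)%N -> f i (x - \sum_(j < m) a j *: e j) = 0.
  elim=> [|m IH] mn; first by exists (fun=> 0).
  have [a ha] := IH (ltnW mn).
  exists (fun j => if j == m then f m (x - \sum_(j < m) a j *: e j) else a j).
  move=> i im; rewrite big_ord_recr /= eqxx.
  under eq_bigr => j _ do rewrite ltn_eqF//.
  rewrite opprD addrA linearB linearZ /= scale_regE.
  move: im; rewrite ltnS leq_eqVlt => /predU1P[->|im].
    by rewrite fe // mulr1 subrr.
  by rewrite ha // fe0 ?im ?mulr0 ?subrr.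
set z := x - _ in ha.
have z0 : 0 < `|z| by rewrite normr_gt0 subr_eq0.
pose u := `|z|^-1 *: z.
have u1 : `|u| = 1 by rewrite normrZ gtr0_norm ?invr_gt0// mulVf// gt_eqF.
have [|phi [_ phi1 phiu]] := @helly _ _ 1 (fun=> u) (fun=> 1).
  by move=> c; rewrite !big_ord1 mulr1 normrZ u1 mulr1 ler_norm.
exists (fun i => if (i < n)%N then e i else u),
  (fun i => if (i < n)%N then f i else phi); split.
- by move=> i _ y; case: ifP => [/f1|_]; last exact: phi1.
- by move=> i _; case: ifP => [/fe//|_]; exact: (phiu ord0).
- move=> i j /andP[ij]; rewrite ltnS leq_eqVlt => /predU1P[jE|jn].
    by rewrite jE ltnn -jE ij /u linearZ /= ha ?scaler0// -jE.
  by rewrite jn (ltn_trans ij jn) fe0// ij.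
Qed.

(** The form is the average of the squares f_i(lincomb e v)^2, each at most the squared norm; its
    matrix is M^T M / N with det M = 1. *)
Lemma inscribed_exists N (e : 'I_N -> X) (f : 'I_N -> {linear X -> R^o}) :
  (forall i y, `|f i y| <= `|y|) -> (forall i, f i (e i) = 1) ->
  (forall i j : 'I_N, (i < j)%N -> f i (e j) = 0) ->
  exists2 S, inscribed e S & 0 < \det S.
Proof.
move=> f1 fe fe0; pose M : 'M[R]_N := \matrix_(i, j) f i (e j).
have MvE v i : (M *m v) i 0 = f i (lincomb e v).
  rewrite mxE linear_sum; apply: eq_bigr => j _.
  by rewrite linearZ /= mxE mulrC.
have bM v : bform (M^T *m M) v v = \sum_i f i (lincomb e v) ^+ 2.
  rewrite /bform mulmxA -mulmxA -trmx_mul mxE; apply: eq_bigr => i _.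
  by rewrite mxE MvE expr2.
have bS v : bform (N%:R^-1 *: (M^T *m M)) v v =
    N%:R^-1 * \sum_i f i (lincomb e v) ^+ 2.
  by rewrite -bM /bform -scalemxAr -scalemxAl mxE.
exists (N%:R^-1 *: (M^T *m M)).
  split.
  - by rewrite linearZ /= trmx_mul trmxK.
  - by move=> v; rewrite bS mulr_ge0 ?invr_ge0// sumr_ge0// => i _; exact: sqr_ge0.
  - move=> v; rewrite bS; have [N0|N0] := posnP N.
      by have -> : N%:R = 0 :> R; rewrite ?N0// invr0 mul0r sqr_ge0.
    rewrite mulrC ler_pdivrMr ?ltr0n// mulr_natr -[X in _ *+ X](card_ord N).
    rewrite -sumr_const; apply: ler_sum => i _.
    by rewrite -real_normK ?num_real// ler_pXn2r ?nnegrE.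
rewrite detZ det_mulmx det_tr det_trig; last first.
  by apply/is_trig_mxP => i j ij; rewrite mxE fe0.
rewrite big1 => [|i _]; last by rewrite mxE fe.
rewrite !mulr1; have [->|N0] := posnP N; first by rewrite expr0 ltr01.
by rewrite exprn_gt0// invr_gt0 ltr0n.
Qed.

(* The volume of the inscribed ellipsoid is maximal up to a factor, so
   [inscribed_improve] yields one vector after another, each almost orthogonal
   to its predecessors. *)
Lemma dual_dvoretzky_rogers (infX : infinite_dimensional X) k :
  exists x : 'I_k -> X, (forall i, `|x i| <= 1) /\
    forall a : 'I_k -> R,
      \sum_i a i ^+ 2 <= 4 * `|\sum_i a i *: x i| ^+ 2.
Proof.
(* This makes 2 (k + 1) / N the square of 1 / (4 (k + 1)), the bound wanted for each inner
   product. *)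
pose N := (32 * k.+1 ^ 3)%N.
have Nk : (2 * k.+1 <= N)%N.
  by rewrite leq_mul// -[X in (X <= _)%N]expn1 leq_pexp2l.
have [e' [f' [f1 fe fe0]]] := triangular_system infX N.
pose e (i : 'I_N) := e' i.
have [S0 S0in S0_gt0] : exists2 S, inscribed e S & 0 < \det S.
  apply: (@inscribed_exists _ e (fun i => f' i)).
  - by move=> i y; apply: f1.
  - by move=> i; apply: fe.
  - by move=> i j ij; apply: fe0; rewrite ij /=.
have [K detK] := inscribed_det_le e.
pose kap : R := step_size k * k.+1%:R / 2.
have kap0 : 0 < kap.
  by rewrite /kap /step_size divr_gt0// mulr_gt0// invr_gt0 mulr_gt0// ltr0n fact_gt0.
pose D := [set \det S | S in inscribed e].
have supD : has_sup D.
  by split; [exists (\det S0), S0 | exists K => _ [S Sin <-]; exact: detK].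
have S0D : \det S0 <= sup D by apply: sup_ubound; [exact: supD.2|exists S0].
have D0 : 0 < sup D by exact: lt_le_trans S0D.
have [_ [S Sin <-] Smax] : exists2 d, D d & sup D / (1 + kap) < d.
  by apply: sup_gt; [exact: supD.1|rewrite ltr_pdivrMr ?ltr_pMr; lra].
have S_gt0 : 0 < \det S by apply: le_lt_trans Smax; rewrite divr_ge0; lra.
have step (x : 'I_k -> 'cV[R]_N) : (forall i, bform S (x i) (x i) <= 1) ->
    exists y, [/\ `|lincomb e y| <= 1, 2^-1 <= bform S y y &
    \sum_j bform S (x j) y ^+ 2 <= (4 * k.+1%:R)^-1 ^+ 2].
  move=> x1; have [|y [y1 y2 y3]] := inscribed_improve Sin S_gt0 x1 Nk.
    move=> S' S'in; apply: (@le_lt_trans _ _ (sup D)).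
      by apply: sup_ubound; [exact: supD.2|exists S'].
    by rewrite -/kap mulrC -ltr_pdivrMr// addr_gt0.
  exists y; split => //; apply: le_trans y3 _.
  rewrite /N natrM natrX le_eqVlt; apply/orP; left; apply/eqP.
  have k0 : k.+1%:R != 0 :> R by rewrite pnatr_eq0.
  by move: k0; set K' : R := k.+1%:R => k0; field.
have [St SS0 Sle] := Sin.
have {step} /(_ k (leqnn k))[x [x1 x2 x3]] : forall m, (m <= k)%N ->
    exists x : nat -> 'cV[R]_N,
    [/\ forall i, (i < m)%N -> `|lincomb e (x i)| <= 1,
        forall i, (i < m)%N -> 2^-1 <= bform S (x i) (x i)
      & forall i j, (i < j < m)%N -> `|bform S (x i) (x j)| <= (4 * k.+1%:R)^-1].
  elim=> [|m IH] mk; first by exists (fun=> 0); split=> // i j; rewrite ltn0 andbF.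
  have [x [x1 x2 x3]] := IH (ltnW mk).
  (* The vectors not yet constructed are replaced by 0, which adds nothing to the sum of squares. *)
  have [|y [y1 y2 y3]] := step (fun i : 'I_k => if (i < m)%N then x i else 0).
    move=> i; case: ifP => [im|_]; last by rewrite bform0r.
    by apply: le_trans (Sle _) _; rewrite -[leRHS](expr1n _ 2) ler_pXn2r ?nnegrE// x1.
  exists (fun i => if (i < m)%N then x i else y); split.
  - by move=> i _; case: ifP => // /x1.
  - by move=> i _; case: ifP => // /x2.
  move=> i j /andP[ij]; rewrite ltnS leq_eqVlt => /predU1P[jE|jm]; last first.
    by rewrite jm (ltn_trans ij jm) x3// ij.
  rewrite jE ltnn -jE ij -(@ler_pXn2r _ 2) ?nnegrE ?invr_ge0 ?mulr_ge0//.
  rewrite real_normK ?num_real//; apply: le_trans y3.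
  have ik : (i < k)%N by rewrite (ltn_trans ij)// jE.
  rewrite (bigD1 (Ordinal ik)) //= -jE ij lerDl.
  by apply: sumr_ge0 => l _; exact: sqr_ge0.
exists (fun i => lincomb e (x i)); split; first by move=> i; exact: x1.
move=> a; set g := (4 * k.+1%:R)^-1 in x3.
have offd (i j : 'I_k) : i != j -> `|bform S (x i) (x j)| <= g.
  move=> ij; have [lij|lji|/ord_inj/eqP] := ltngtP i j.
  - by apply: x3; rewrite lij /=.
  - by rewrite bformC//; apply: x3; rewrite lji /=.
  - by rewrite (negbTE ij).
pose w := \sum_(i < k) a i *: x i.
have -> : \sum_(i < k) a i *: lincomb e (x i) = lincomb e w.
  by rewrite lincomb_sum; apply: eq_bigr => i _; rewrite lincombZ.
suff h : \sum_(i < k) a i ^+ 2 <= 4 * bform S w w.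
  by apply: le_trans h _; rewrite ler_pM2l.
have -> : bform S w w = \sum_(i < k) \sum_(j < k) a i * a j * bform S (x i) (x j).
  rewrite bform_suml//; apply: eq_bigr => i _; rewrite bform_sumr.
  by apply: eq_bigr => j _; rewrite bformZr bformZl//; ring.
(* Off the diagonal, |a_i a_j S(x_i, x_j)| <= g (a_i^2 + a_j^2) / 2. After summation this costs g k
   A <= A / 4 out of the A / 2 from the diagonal, which leaves the A / 4 required. *)
have lb (i : 'I_k) : 2^-1 * a i ^+ 2 - \sum_(j < k) g * ((a i ^+ 2 + a j ^+ 2) / 2) <=
    \sum_(j < k) a i * a j * bform S (x i) (x j).
  rewrite (bigD1 i)//= [X in _ <= X](bigD1 i)//= opprD addrA lerD//.
    have : 0 <= g by rewrite /g invr_ge0 mulr_ge0.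
    by have := x2 i (ltn_ord i); nra.
  rewrite -sumrN; apply: ler_sum => j ji.
  have := offd i j; rewrite eq_sym ji => /(_ isT); rewrite ler_norml => /andP[].
  set b := bform _ _ _ => h1 h2.
  have : 0 <= (a i + a j) ^+ 2 * (g + b) by rewrite mulr_ge0 ?sqr_ge0//; lra.
  have : 0 <= (a i - a j) ^+ 2 * (g - b) by rewrite mulr_ge0 ?sqr_ge0//; lra.
  by lra.
have : \sum_(i < k) (2^-1 * a i ^+ 2 - \sum_(j < k) g * ((a i ^+ 2 + a j ^+ 2) / 2)) <=
    \sum_(i < k) \sum_(j < k) a i * a j * bform S (x i) (x j).
  by apply: ler_sum => i _; exact: lb.
set A := \sum_i a i ^+ 2.
have -> : \sum_i (2^-1 * a i ^+ 2 - \sum_j g * ((a i ^+ 2 + a j ^+ 2) / 2)) =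
    2^-1 * A - g * k%:R * A.
  rewrite sumrB -mulr_sumr; congr (_ - _).
  under eq_bigr do rewrite -mulr_sumr -mulr_suml big_split /= sumr_const card_ord.
  rewrite -mulr_sumr -mulr_suml big_split /= -/A sumr_const card_ord sumrMnl -/A.
  by rewrite -mulr_natr; field.
have gk : g * k%:R <= 4^-1.
  rewrite /g invfM -mulrA ler_piMr// mulrC ler_pdivrMr ?ltr0n// mul1r ler_nat//.
have A0 : 0 <= A by apply: sumr_ge0 => i _; exact: sqr_ge0.
have := ler_wpM2r A0 gk; lra.
Qed.

End DvoretzkyRogers.

(** * Finitely supported laws *)

Section UniformProbability.
Context d (T : measurableType d) (R : realType) (n : nat) (y : nat -> T).

Definition uniform_points : set T -> \bar R :=
  mscale (n.+1%:R^-1)%:nng (msum (fun i => \d_(y i)) n.+1).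

HB.instance Definition _ := Measure.on uniform_points.

Lemma uniform_pointsE A :
  uniform_points A = (n.+1%:R^-1 * \sum_(i < n.+1) \1_A (y i))%:E.
Proof.
rewrite /uniform_points /mscale /= /msum EFinM; congr (_ * _)%E.
by rewrite -sumEFin; apply: eq_bigr => i _.
Qed.

Let uniform_points_setT : uniform_points [set: T] = 1%E.
Proof.
rewrite uniform_pointsE; under eq_bigr do rewrite indicT.
by rewrite sumr_const card_ord mulVf// pnatr_eq0.
Qed.

HB.instance Definition _ :=
  Measure_isProbability.Build _ _ _ uniform_points uniform_points_setT.

Lemma ge0_integral_uniform_points (f : T -> R) : measurable_fun setT f ->
  (forall x, 0 <= f x) -> (\int[uniform_points]_x (f x)%:E =
   (n.+1%:R^-1 * \sum_(i < n.+1) f (y i))%:E)%E.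
Proof.
move=> mf f0; rewrite ge0_integral_mscale//=; last 2 first.
- exact/measurable_EFinP.
- by move=> x _; rewrite lee_fin.
rewrite EFinM; congr (_ * _)%E.
rewrite (@ge0_integral_measure_sum _ _ _ (fun i => \d_(y i)))//=; last 2 first.
- by move=> x _; rewrite lee_fin.
- exact/measurable_EFinP.
rewrite -sumEFin; apply: eq_bigr => i _.
rewrite integral_dirac//= ?diracT ?mul1e//.
exact/measurable_EFinP.
Qed.

Lemma Rintegral_uniform_points (f : T -> R) : measurable_fun setT f ->
  (\int[uniform_points]_x f x = n.+1%:R^-1 * \sum_(i < n.+1) f (y i))%R.
Proof.
move=> mf; rewrite /Rintegral integralE.
rewrite funerpos funerneg.
rewrite !ge0_integral_uniform_points//=.
- rewrite -mulrBr -sumrB; congr (_ * _); apply: eq_bigr => i _.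
  by rewrite -[in RHS](funrposBneg f).
- exact: measurable_funrneg.
- exact: measurable_funrpos.
Qed.

End UniformProbability.

(** * Gaussian variables and processes *)

Section IntegralComparisons.
Local Open Scope ereal_scope.
Context d (T : measurableType d) (R : realType).
Import HBNNSimple.

(* No measurability of the larger function: the integral of a nonnegative
   function is a supremum over the simple functions below it. *)
Lemma ge0_le_integralT (mu : {measure set T -> \bar R}) (f g : T -> \bar R) :
  (forall x, 0 <= f x) -> (forall x, f x <= g x) ->
  \int[mu]_x f x <= \int[mu]_x g x.
Proof.
move=> f0 fg; have g0 x : 0 <= g x by exact: le_trans (fg x).
rewrite !ge0_integralTE//; apply: ereal_sup_le => _ [h hf <-].
by exists h => // x; exact: le_trans (hf x) (fg x).
Qed.

(** The integral on the left is a supremum over simple functions h <= f, and for such h the density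
    formula applies on each level set. *)
Lemma integral_density_le (mu nu : {measure set T -> \bar R}) (p f : T -> R) :
  measurable_fun setT p -> (forall x, (0 <= p x)%R) ->
  (forall A, measurable A -> nu A = \int[mu]_(x in A) (p x)%:E) ->
  (forall x, (0 <= f x)%R) ->
  \int[nu]_x (f x)%:E <= \int[mu]_x (f x * p x)%:E.
Proof.
move=> mp p0 nuE f0.
rewrite ge0_integralTE; last by move=> x; rewrite lee_fin.
apply: ge_ereal_sup => _ [h /= hf <-].
apply: (@le_trans _ _ (\int[mu]_x (h x * p x)%:E)); last first.
  apply: ge0_le_integralT => x; first by rewrite lee_fin mulr_ge0.
  by rewrite lee_fin ler_wpM2r// -lee_fin; exact: hf.
rewrite sintegralE.
(* On the range y = |y|; the absolute value makes the summand nonnegative for every real index, as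
   the interchange of sum and integral demands. *)
have piece y : range h y -> y%:E * nu (h @^-1` [set y]) =
    \int[mu]_x (`|y| * \1_(h @^-1` [set y]) x * p x)%:E.
  move=> [x _ <-]; rewrite nuE// ger0_norm//; set A := h @^-1` _.
  have mA : measurable A by exact: measurable_funPTI.
  rewrite -ge0_integralZl//; last 3 first.
  - by apply/measurable_EFinP; exact: measurable_funTS.
  - by move=> z _; rewrite lee_fin.
  - by rewrite lee_fin.
  rewrite integral_mkcond; apply: eq_integral => z _.
  rewrite patchE indicE; case: ifPn => zA; first by rewrite mulr1 EFinM.
  by rewrite mulr0 mul0r.
under eq_fsbigr => y yh do rewrite (piece y (set_mem yh)).
rewrite -ge0_integral_fsum//.
- apply: ge0_le_integralT => x.
    by apply: fsume_ge0 => y _; rewrite lee_fin !mulr_ge0// indicE ler0n.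
  rewrite fsumEFin// -mulr_fsuml lee_fin [in leRHS](fimfunE h).
  rewrite le_eqVlt; apply/orP; left; apply/eqP; congr (_ * _)%R.
  by apply: eq_fsbigr => y /set_mem[z _ <-]; rewrite ger0_norm.
- move=> y; apply/measurable_EFinP; apply: measurable_funM => //.
  by apply: measurable_funM => //; exact: measurable_indic.
- by move=> y x _; rewrite lee_fin !mulr_ge0// indicE ler0n.
Qed.

Lemma integral_comp_law d2 (T2 : measurableType d2)
    (mu : {measure set T -> \bar R}) (nu : {measure set T2 -> \bar R})
    (Z : T -> T2) (f : T2 -> R) :
  measurable_fun setT Z -> measurable_fun setT f -> (forall x, (0 <= f x)%R) ->
  (forall A, measurable A -> mu (Z @^-1` A) = nu A) ->
  \int[mu]_w (f (Z w))%:E = \int[nu]_x (f x)%:E.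
Proof.
move=> mZ mf f0 law.
have := @ge0_integral_pushforward _ _ _ _ _ _ mZ mu setT (EFin \o f) measurableT.
rewrite preimage_setT => <-; last 2 first.
- exact/measurable_EFinP.
- by move=> x _; rewrite /= lee_fin.
apply: (@eq_measure_integral _ _ _ setT nu
  (measure_function_pushforward__canonical__measure_function_Measure mu mZ)).
by move=> A mA _; exact: law.
Qed.

End IntegralComparisons.

Section GaussianMoments.
Context {R : realType}.

(** With z = (x - m)^2 / (4 s^2) the Gaussian factor is e^(-z) e^(-z). One factor absorbs the
    square, since z e^(-z) <= 1; the other belongs to the normal density of deviation sqrt 2 s. The
    constant is 4 sqrt 2 <= 6. *)
Lemma normal_pdf_second_moment (m s x : R) : s != 0 ->
  (x - m) ^+ 2 * normal_pdf m s x <=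
  6 * s ^+ 2 * normal_pdf m (Num.sqrt 2 * s) x.
Proof.
move=> s0; set s' := Num.sqrt 2 * s.
have s'0 : s' != 0 by rewrite mulf_neq0// gt_eqF// sqrtr_gt0.
have s'2 : s' ^+ 2 = 2 * s ^+ 2 by rewrite exprMn sqr_sqrtr.
have s20 : 0 < s ^+ 2 by rewrite exprn_even_gt0.
rewrite /normal_pdf (negbTE s0) (negbTE s'0).
have -> : normal_peak s = Num.sqrt 2 * normal_peak s'.
  rewrite /normal_peak s'2.
  have -> : 2 * s ^+ 2 * pi *+ 2 = 2 * (s ^+ 2 * pi *+ 2) by ring.
  by rewrite sqrtrM ?ler0n// invfM mulrA mulfV ?mul1r// gt_eqF// sqrtr_gt0.
rewrite /normal_fun s'2; set y := x - m.
pose z := y ^+ 2 / (4 * s ^+ 2).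
have -> : - y ^+ 2 / (s ^+ 2 *+ 2) = - z + - z.
  by rewrite /z; field.
have -> : - y ^+ 2 / (2 * s ^+ 2 *+ 2) = - z.
  by rewrite /z; field.
rewrite expRD.
have -> : y ^+ 2 = 4 * s ^+ 2 * z by rewrite /z; field.
have ze : z * expR (- z) <= 1.
  rewrite expRN ler_pdivrMr ?expR_gt0// mul1r.
  by apply: le_trans (expR_ge1Dx z); rewrite lerDr.
have q2 : Num.sqrt 2 <= 3 / 2 :> R.
  rewrite -[leRHS]ger0_norm; last lra.
  by rewrite -sqrtr_sqr ler_wsqrtr//; lra.
have p0 : 0 <= normal_peak s' by exact: normal_peak_ge0.
have e0 : 0 <= expR (- z) by exact: expR_ge0.
have -> : 4 * s ^+ 2 * z * (Num.sqrt 2 * normal_peak s' * (expR (- z) * expR (- z))) =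
  (4 * Num.sqrt 2 * (z * expR (- z))) * (s ^+ 2 * (normal_peak s' * expR (- z))) by ring.
rewrite -[leRHS]mulrA; apply: ler_wpM2r; first by apply: mulr_ge0; [exact: ltW|exact: mulr_ge0].
have h : 0 <= Num.sqrt 2 :> R by exact: sqrtr_ge0.
have h2 : 4 * Num.sqrt 2 <= 6 :> R by lra.
apply: le_trans h2.
by rewrite ler_piMr// mulr_ge0.
Qed.

Lemma integral_sqr_normal_prob (m s : R) : s != 0 ->
  (\int[normal_prob m s]_x ((x - m) ^+ 2)%:E <= (6 * s ^+ 2)%:E)%E.
Proof.
move=> s0.
have h := @integral_density_le _ _ R lebesgue_measure (normal_prob m s)
  (normal_pdf m s) (fun x => (x - m) ^+ 2) (measurable_normal_pdf m s)
  (normal_pdf_ge0 m s) (fun A _ => erefl) (fun x => sqr_ge0 (x - m)).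
apply: (le_trans h).
apply: (@le_trans _ _ (\int[lebesgue_measure]_x
    ((6 * s ^+ 2)%R%:E * (normal_pdf m (Num.sqrt 2 * s)%R x)%:E))%E).
  apply: ge0_le_integralT => x.
    by rewrite lee_fin mulr_ge0 ?sqr_ge0 ?normal_pdf_ge0.
  by rewrite -EFinM lee_fin normal_pdf_second_moment.
rewrite ge0_integralZl//=.
- by rewrite integral_normal_pdf mule1.
- by apply/measurable_EFinP; exact: measurable_normal_pdf.
- by move=> x _; rewrite lee_fin normal_pdf_ge0.
- by rewrite lee_fin mulr_ge0// sqr_ge0.
Qed.

(** The interval has length |s| and the density is at most 1 / (2 |s|), because pi >= 2. *)
Lemma normal_prob_interval_le (m s : R) : s != 0 ->
  (normal_prob m s `[(- (`|s| / 2))%R, (`|s| / 2)%R]%classic <= (2^-1)%:E)%E.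
Proof.
move=> s0; have s1 : 0 < `|s| by rewrite normr_gt0.
apply: (@le_trans _ _ (\int[lebesgue_measure]_(x in `[(- (`|s| / 2))%R, (`|s| / 2)%R]%classic) (normal_peak s)%:E)%E).
  apply: ge0_le_integral => //=.
  - by move=> x _; rewrite lee_fin normal_pdf_ge0.
  - by apply/measurable_EFinP/measurable_funTS; exact: measurable_normal_pdf.
  - by move=> x _; rewrite lee_fin normal_pdf_ub.
rewrite integral_cst//= lebesgue_measure_itv/= lte_fin ifT; last lra.
rewrite -EFinB -EFinM lee_fin.
have -> : `|s| / 2 - - (`|s| / 2) = `|s| by field.
have h : 2 * `|s| <= Num.sqrt (s ^+ 2 * pi *+ 2).
  have -> : 2 * `|s| = Num.sqrt ((2 * `|s|) ^+ 2).
    by rewrite sqrtr_sqr normrM normr_id normr_nat.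
  rewrite ler_wsqrtr// exprMn real_normK ?num_real// mulr2n.
  have := pi_ge2 R; have := sqr_ge0 s; nra.
rewrite /normal_peak mulrC ler_pdivrMr; first by lra.
by apply: lt_le_trans h; rewrite mulr_gt0.
Qed.

Context d (S : measurableType d) (Q : probability S R).

(** As Z has mean 0, v = E Z^2 <= E (Z - m)^2 <= 6 s^2, and 96 = 6 * 16 gives r <= |s| / 4. Since
    |Z| > |s| / 2 with probability at least 1/2, E |Z| >= |s| / 4. A degenerate law would force v <=
    0. *)
Lemma normal_law_first_moment_ge (Z : {RV Q >-> R}) (m s v r : R) :
  normal_law Q Z m s -> Q.-integrable setT (EFin \o Z) ->
  (\int[Q]_w (Z w)%:E = 0)%E -> (\int[Q]_w (Z w ^+ 2)%:E = v%:E)%E ->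
  0 < r -> 96 * r ^+ 2 <= v -> (r%:E <= \int[Q]_w `|Z w|%:E)%E.
Proof.
move=> lawZ iZ Z1 Z2 r0 rv.
have v0 : 0 < v by apply: lt_le_trans rv; rewrite mulr_gt0// exprn_gt0.
have mZ2 : measurable_fun setT (fun w => Z w ^+ 2) by exact: measurable_funX.
have iZ2 : Q.-integrable setT (EFin \o (fun w => Z w ^+ 2)).
  apply/integrableP; split; first exact/measurable_EFinP.
  under eq_integral do rewrite /= ger0_norm ?sqr_ge0//.
  by rewrite Z2 ltry.
have vle : (v%:E <= \int[Q]_w ((Z w - m) ^+ 2)%:E)%E.
  have -> : (\int[Q]_w ((Z w - m) ^+ 2)%:E = \int[Q]_w ((EFin \o (fun w => (Z w ^+ 2)%R)) w +
      ((- (2 * m))%R%:E * (EFin \o Z) w + (EFin \o cst (m ^+ 2)%R) w)))%E.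
    by apply: eq_integral => w _ /=; rewrite -!EFinM -!EFinD; congr EFin; ring.
  have ic : Q.-integrable setT (EFin \o cst (m ^+ 2)) by exact: finite_measure_integrable_cst.
  have iZm : Q.-integrable setT (fun w => (- (2 * m))%R%:E * (EFin \o Z) w)%E.
    exact: integrableZl.
  rewrite integralD//; last exact: integrableD.
  rewrite integralD// integralZl// Z1 mule0 add0e Z2.
  by rewrite leeDl// integral_ge0// => w _; rewrite lee_fin sqr_ge0.
have mZ : measurable_fun setT (Z : S -> measurableTypeR R).
  exact: (@measurable_funPT _ _ S R Z).
have msqr : measurable_fun setT (fun x : measurableTypeR R => (x - m) ^+ 2).
  by apply: measurable_funX; exact: measurable_funB.
have [s0|s0] := eqVneq s 0.
  exfalso; move: vle; rewrite (@integral_comp_law _ _ _ _ _ Q \d_m _ _ mZ msqr).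
  - rewrite integral_dirac//; last exact/measurable_EFinP.
    by rewrite subrr expr0n /= mule0 lee_fin leNgt v0.
  - by move=> x; exact: sqr_ge0.
  - by move=> A mA; have := lawZ A mA; rewrite s0 eqxx.
have lawN A : measurable A -> Q (Z @^-1` A) = normal_prob m s A.
  by move=> mA; have := lawZ A mA; rewrite (negbTE s0).
have x0 (x : R) : 0 <= (x - m) ^+ 2 by exact: sqr_ge0.
rewrite (@integral_comp_law _ _ _ _ _ Q (normal_prob m s) _ _ mZ msqr x0 lawN) in vle.
have vs : v <= 6 * s ^+ 2.
  by have := le_trans vle (integral_sqr_normal_prob m s0); rewrite lee_fin.
have rs : r <= `|s| / 4.
  have : 16 * r ^+ 2 <= s ^+ 2 by lra.
  rewrite -[s ^+ 2]real_normK ?num_real//.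
  have := normr_ge0 s; move: `|s| => u; nra.
pose A := [set w | `|s| / 2 < `|Z w|].
have mA : measurable A.
  rewrite /A -[X in measurable X]setTI.
  have mnZ : measurable_fun setT (fun w => `|Z w|) by exact: measurableT_comp.
  have := mnZ measurableT _ (measurable_itv `]`|s| / 2, +oo[).
  by congr measurable; congr (_ `&` _); apply/seteqP; split => w /=; rewrite in_itv/= andbT.
have QA : ((2^-1)%:E <= Q A)%E.
  have CA : ~` A = Z @^-1` `[(- (`|s| / 2))%R, (`|s| / 2)%R]%classic.
    apply/seteqP; split => w /=; rewrite in_itv /= -ler_norml.
      by move/negP; rewrite -leNgt.
    by move=> h; apply/negP; rewrite -leNgt.
  have : (Q (~` A) <= (2^-1)%:E)%E by rewrite CA lawN// normal_prob_interval_le.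
  rewrite probability_setC// => h.
  have fA : Q A \is a fin_num by exact: fin_num_measure.
  by move: h; rewrite -(fineK fA) -EFinB !lee_fin; lra.
apply: (@le_trans _ _ (\int[Q]_w (`|s| / 2 * \1_A w)%:E)%E); last first.
  apply: ge0_le_integralT => w.
    by rewrite lee_fin mulr_ge0 ?divr_ge0// indicE ler0n.
  rewrite lee_fin indicE; case: (boolP (w \in A)) => [/set_mem/ltW|_].
    by rewrite mulr1.
  by rewrite mulr0.
under eq_integral do rewrite EFinM.
rewrite ge0_integralZl//=; last by apply/measurable_EFinP; exact: measurable_indic.
rewrite integral_indic// setIT.
apply: (@le_trans _ _ ((`|s| / 2)%:E * (2^-1)%:E)%E).
  by rewrite -EFinM lee_fin; lra.
by apply: lee_wpmul2l => //; rewrite lee_fin divr_ge0.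
Qed.

End GaussianMoments.

Section GaussianProcesses.
Context d (T : measurableType d) (R : realType).
Variables (F : set (T -> R)) (K : (T -> R) -> (T -> R) -> R).
Context d' (S : measurableType d') (Q : probability S R).
Variable G : (T -> R) -> {RV Q >-> R}.
Hypothesis gpG : centered_gaussian_process F K G.

Lemma gaussian_process_cov f g : F f -> F g ->
  (\int[Q]_w (G f w * G g w)%:E = (K f g)%:E)%E.
Proof.
case: gpG => _ G0 GK Ff Fg; rewrite -GK// covariance.unlock !G0//=.
by rewrite unlock; apply: eq_integral => w _ /=; rewrite !fctE /= !subr0.
Qed.

Lemma gaussian_process_sqr_integrable f : F f ->
  Q.-integrable setT (EFin \o (fun w => G f w ^+ 2)).
Proof.
move=> Ff; apply/integrableP; split.
  by apply/measurable_EFinP; exact: measurable_funX.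
under eq_integral do rewrite /= ger0_norm ?sqr_ge0// expr2.
by rewrite gaussian_process_cov// ltry.
Qed.

Lemma gaussian_process_mul_integrable f g : F f -> F g ->
  Q.-integrable setT (EFin \o (fun w => G f w * G g w)).
Proof.
move=> Ff Fg.
apply: (@le_integrable _ _ _ Q setT measurableT _
  ((EFin \o (fun w => G f w ^+ 2)%R) \+ (EFin \o (fun w => G g w ^+ 2)%R))%E).
- by apply/measurable_EFinP; exact: measurable_funM.
- move=> w _ /=; rewrite lee_fin normrM [leRHS]ger0_norm ?addr_ge0 ?sqr_ge0//.
  rewrite -[G f w ^+ 2]real_normK ?num_real// -[G g w ^+ 2]real_normK ?num_real//.
  have := sqr_ge0 (`|G f w| - `|G g w|).
  have := normr_ge0 (G f w); have := normr_ge0 (G g w).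
  by move: (`|G f w|) (`|G g w|) => x y; nra.
- by apply: integrableD => //; exact: gaussian_process_sqr_integrable.
Qed.

Lemma gaussian_process_integrable f : F f ->
  Q.-integrable setT (EFin \o G f).
Proof.
move=> Ff.
apply: (@le_integrable _ _ _ Q setT measurableT _
  ((EFin \o cst 1%R) \+ (EFin \o (fun w => G f w ^+ 2)%R))%E).
- by apply/measurable_EFinP.
- move=> w _ /=; rewrite lee_fin [leRHS]ger0_norm ?addr_ge0 ?sqr_ge0//.
  rewrite -[G f w ^+ 2]real_normK ?num_real//.
  by have := sqr_ge0 (`|G f w| - 1); have := normr_ge0 (G f w); nra.
- apply: integrableD => //; first exact: finite_measure_integrable_cst.
  exact: gaussian_process_sqr_integrable.
Qed.

(** The process is indexed by a mere set of functions, so its linearity is expressed through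
    relations: a combination orthogonal to all its terms for [K] has variance 0. *)
Lemma gaussian_process_ae0 n (g : 'I_n -> T -> R) (c : 'I_n -> R) :
  (forall i, F (g i)) -> (forall i, \sum_j c j * K (g i) (g j) = 0) ->
  {ae Q, forall w, \sum_i c i * G (g i) w = 0}.
Proof.
move=> Fg cK.
pose W w := \sum_i c i * G (g i) w.
have mW : measurable_fun setT W.
  by apply: measurable_sum => i; apply: measurable_funM.
have W2 : (\int[Q]_w (W w ^+ 2)%:E = 0)%E.
  have E w : ((W w ^+ 2)%:E = \sum_i \sum_j (c i * c j)%:E *
      (EFin \o (fun w => G (g i) w * G (g j) w)%R) w)%E.
    rewrite expr2 /W mulr_suml -sumEFin; apply: eq_bigr => i _.
    rewrite mulr_sumr -sumEFin; apply: eq_bigr => j _ /=.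
    by rewrite -EFinM; congr EFin; ring.
  under eq_integral do rewrite E.
  have iGG i j : Q.-integrable setT (fun w => ((c i * c j)%:E *
      (EFin \o (fun w => G (g i) w * G (g j) w)%R) w)%E).
    by apply: integrableZl => //; exact: gaussian_process_mul_integrable.
  rewrite integral_sum//; last by move=> i; exact: integrable_sum.
  rewrite big1// => i _; rewrite integral_sum//.
  transitivity (\sum_j (c i * (c j * K (g i) (g j)))%:E)%E.
    apply: eq_bigr => j _.
    rewrite integralZl//; last exact: gaussian_process_mul_integrable.
    by rewrite gaussian_process_cov// -EFinM mulrA.
  by rewrite sumEFin -mulr_sumr cK mulr0.
have mW2 : measurable_fun setT (fun w => (W w ^+ 2)%:E).
  by apply/measurable_EFinP; exact: measurable_funX.
have /(ae_eq_integral_abs Q measurableT mW2) :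
    (\int[Q]_w `|(W w ^+ 2)%:E| = 0)%E.
  by under eq_integral do rewrite gee0_abs ?lee_fin ?sqr_ge0//.
apply: filterS => w /(_ I) [] /eqP.
by rewrite sqrf_eq0 => /eqP.
Qed.

Lemma gaussian_process_first_moment_ge f (r : R) : F f -> 0 < r ->
  96 * r ^+ 2 <= K f f -> (r%:E <= \int[Q]_w `|G f w|%:E)%E.
Proof.
move=> Ff r0 rK; have [nG G0 _] := gpG.
have [m [s]] := nG 1%N (fun=> f) (fun=> 1) (fun=> Ff).
under [X in normal_law _ X]funext do rewrite big_ord1 mul1r.
move=> lawG; apply: (normal_law_first_moment_ge lawG) rK => //.
- exact: gaussian_process_integrable.
- by have := G0 f Ff; rewrite unlock.
- by under eq_integral do rewrite expr2; exact: gaussian_process_cov.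
Qed.

End GaussianProcesses.

(** * The dual ball is not uniformly Donsker *)

Section DualBall.
Context {R : realType} {X : normedModType R}.

Lemma dual_unit_ball_measurable (f : borel_ball X -> R) :
  dual_unit_ball f -> measurable_fun setT f.
Proof.
move=> [phi [cphi _ fE]].
apply: (measurability (RGenOInfty.G (R := R))) => //.
  exact: RGenOInfty.measurableE.
move=> _ [_ [a ->] <-]; rewrite setTI; apply: sub_sigma_algebra.
have cf : continuous (f : set_type (@unit_ball R X) -> R).
  rewrite fE => z; apply: continuous_comp; last exact: cphi.
  exact: (@initial_continuous _ _ (@set_val X (@unit_ball R X))).
by move/continuousP : cf; apply; exact: rray_open.
Qed.

Definition ball_point (x : X) : borel_ball X :=
  if pselect (`|x| <= 1) is left h
  then exist (fun x : X => x \in @unit_ball R X) x (mem_set (h : unit_ball x))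
  else point.

Lemma ball_pointK x : `|x| <= 1 -> ball_val (ball_point x) = x.
Proof. by rewrite /ball_point; case: pselect. Qed.

Lemma norm_ball_val (x : borel_ball X) : `|ball_val x| <= 1.
Proof. exact: (set_mem (valP (x : set_type (@unit_ball R X)))). Qed.

Lemma contraction_in_dual_ball (phi : {linear X -> R^o}) : continuous phi ->
  (forall x, `|phi x| <= `|x|) -> dual_unit_ball (phi \o @ball_val R X).
Proof. by move=> cphi phi1; exists phi; split => // x; exact: le_trans. Qed.

End DualBall.

Lemma bridge_cov_uniform_points d (T : measurableType d) (R : realType) n
    (y : nat -> T) (f g : T -> R) :
  measurable_fun setT f -> measurable_fun setT g ->
  bridge_cov (@uniform_points _ T R n y) f g =
  n.+1%:R^-1 * \sum_(i < n.+1) f (y i) * g (y i)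
  - (n.+1%:R^-1 * \sum_(i < n.+1) f (y i)) * (n.+1%:R^-1 * \sum_(i < n.+1) g (y i)).
Proof.
move=> mf mg; rewrite /bridge_cov !Rintegral_uniform_points//.
exact: measurable_funM.
Qed.

Section NotDonsker.
Context {R : realType} {X : completeNormedModType R}.
Hypothesis infX : infinite_dimensional X.
Let F := @dual_unit_ball R X.

(** The hypothesis supplies a regular version, without which [mean_modulus] is a supremum over the
    empty set. With k = (m + 2)^2 the radius 1 / (2 sqrt k) is rational. Each G(h_i) has variance (1
    - 1/k) / (4 k^2) >= 1 / (8 k^2), and 96 / 28^2 = 6/49 <= 1/8, so the k terms have mean at least
    1 / (28 k) each. *)
Lemma mean_modulus_ge (m : nat) : uniform_donsker F ->
  exists P : probability (borel_ball X) R,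
    (28^-1%:E <= mean_modulus F P (2 * m.+2%:R)^-1)%E.
Proof.
move=> [hP _ _].
set k := (m.+2 ^ 2)%N; pose k' := (m.+2 ^ 2).-1.
have kE : k'.+1 = k by rewrite /k' prednK ?expn_gt0.
have [x0 [x1 xl2]] := dual_dvoretzky_rogers infX k'.+1.
pose y (i : nat) := ball_point (x0 (inord i)).
have yE (i : 'I_k'.+1) : ball_val (y i) = x0 i by rewrite /y inord_val ball_pointK.
pose P : probability (borel_ball X) R := @uniform_points _ (borel_ball X) R k' y.
exists P.
set beta : R := (2 * m.+2%:R)^-1.
have beta0 : 0 < beta by rewrite invr_gt0 mulr_gt0.
have kR : k'.+1%:R = m.+2%:R ^+ 2 :> R by rewrite kE natrX.
have beta2 : beta ^+ 2 = (4 * k'.+1%:R)^-1.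
  rewrite kR /beta; have : m.+2%:R != 0 :> R by rewrite pnatr_eq0.
  by move: (m.+2%:R) => z z0; field.
have fun_ex (c : 'I_k'.+1 -> R) : (forall i, `|c i| <= 1) ->
    exists f, F f /\ forall i : 'I_k'.+1, f (y i) = beta * c i.
  move=> c1.
  have [|phi [cphi phi1 phic]] := @helly _ _ _ x0 (fun i => beta * c i).
    move=> a; set n := `|_|.
    have n0 : 0 <= n by exact: normr_ge0.
    have an := xl2 a; rewrite -/n in an.
    have [nE|n_neq0] := eqVneq n 0.
      rewrite nE expr0n mulr0 /= in an.
      rewrite big1 ?nE// => i _.
      have ai : a i ^+ 2 <= 0.
        apply: le_trans an; rewrite (bigD1 i)//= lerDl.
        by apply: sumr_ge0 => j _; exact: sqr_ge0.
      have : a i ^+ 2 == 0 by rewrite eq_le ai sqr_ge0.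
      by rewrite sqrf_eq0 => /eqP ->; rewrite mul0r.
    have n_gt0 : 0 < n by rewrite lt0r n_neq0.
    (* Cauchy-Schwarz in the form of a weighted inequality of means. The first terms sum to at most
       n / 2 since |a|^2 <= 4 n^2, the second ones to n / 2 since beta^2 = 1 / (4 k). *)
    apply: (@le_trans _ _ (\sum_i (a i ^+ 2 / (8 * n) + 2 * n * beta ^+ 2))).
      apply: ler_sum => i _.
      have n2 : 0 <= 2 * n by lra.
      have ci : c i ^+ 2 <= 1.
        by rewrite -real_normK ?num_real// -(expr1n _ 2) ler_pXn2r ?nnegrE.
      have := ler_wpM2l n2 (ler_wpM2l (sqr_ge0 beta) ci); rewrite mulr1.
      have : 0 <= 2 * n * (a i / (4 * n) - beta * c i) ^+ 2.
        by rewrite mulr_ge0// sqr_ge0.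
      have -> : 2 * n * (a i / (4 * n) - beta * c i) ^+ 2 =
          a i ^+ 2 / (8 * n) - a i * (beta * c i) + 2 * n * (beta ^+ 2 * c i ^+ 2).
        by field.
      by lra.
    rewrite big_split /= sumr_const card_ord beta2.
    have -> : (2 * n * (4 * k'.+1%:R)^-1) *+ k'.+1 = n / 2.
      have : k'.+1%:R != 0 :> R by rewrite pnatr_eq0.
      by rewrite -[LHS]mulr_natr; move: (k'.+1%:R) => z z0; field.
    have h8 : 0 < 8 * n by lra.
    have : \sum_i a i ^+ 2 / (8 * n) <= n / 2.
      by rewrite -mulr_suml ler_pdivrMr//; nra.
    by lra.
  exists (phi \o @ball_val R X); split; first exact: contraction_in_dual_ball.
  by move=> i /=; rewrite yE.
have [f0 [Ff0 f0y]] := fun_ex (fun=> 0) (fun i => ltac:(by rewrite normr0)).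
have /choice[h hP'] : forall i : 'I_k'.+1, exists f, F f /\
    forall j : 'I_k'.+1, f (y j) = beta * (j == i)%:R.
  by move=> i; apply: (fun_ex (fun j => (j == i)%:R)) => j; case: eqP; rewrite ?normr1 ?normr0.
have /choice[fs fsP] : forall s : {ffun 'I_k'.+1 -> bool}, exists f, F f /\
    forall j : 'I_k'.+1, f (y j) = beta * (-1) ^+ s j.
  by move=> s; apply: (fun_ex (fun j => (-1) ^+ s j)) => j; rewrite normrX normrN1 expr1n.
have mF f : F f -> measurable_fun setT f by exact: dual_unit_ball_measurable.
have [d' [S [Q [G rG]]]] := hP P.
have [gpG _ _] := rG.
have lin (c : 'I_k'.+1 -> R) f : F f -> (forall i : 'I_k'.+1, f (y i) = beta * c i) ->
    {ae Q, forall w, G f w = \sum_i c i * G (h i) w}.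
  move=> Ff fy.
  (* Slot 0 holds [f] with coefficient 1, the other slots the [h i] with coefficients - c i. This
     combination vanishes at all the points that carry [P], hence is orthogonal to everything for
     [bridge_cov P]. *)
  pose g (a : 'I_k'.+2) := oapp h f (unlift ord0 a).
  pose e (a : 'I_k'.+2) := oapp (fun i => - c i) 1 (unlift ord0 a).
  have Fg a : F (g a) by rewrite /g; case: unlift => [i|] //=; exact: (hP' i).1.
  have eg (j : 'I_k'.+1) : \sum_a e a * g a (y j) = 0.
    rewrite big_ord_recl /e /g unlift_none /= mul1r.
    under eq_bigr do rewrite liftK /= (hP' _).2.
    rewrite (bigD1 j)//= eqxx big1 ?addr0 ?fy; last first.
      by move=> i ij; rewrite eq_sym (negbTE ij) !mulr0.
    by rewrite mulr1; ring.
  have cov0 a : \sum_b e b * bridge_cov P (g a) (g b) = 0.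
    set A := k'.+1%:R^-1 * \sum_(i < k'.+1) g a (y i).
    transitivity (\sum_b \sum_(j < k'.+1)
        k'.+1%:R^-1 * (g a (y j) - A) * (e b * g b (y j))).
      apply: eq_bigr => b _.
      rewrite (bridge_cov_uniform_points _ _ (mF _ (Fg a)) (mF _ (Fg b))) -/A.
      rewrite (mulrCA A) -mulrBr [A * _]mulr_sumr -sumrB mulrA mulr_sumr.
      by apply: eq_bigr => j _; ring.
    rewrite exchange_big big1// => j _.
    by rewrite -mulr_sumr eg mulr0.
  have := gaussian_process_ae0 gpG Fg cov0.
  apply: filterS => w.
  rewrite big_ord_recl /e /g unlift_none /= mul1r.
  under eq_bigr do rewrite liftK /= mulNr.
  by rewrite sumrN => /eqP; rewrite subr_eq0 => /eqP.
pose phi w := \sum_i `|G (h i) w|.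
have mphi : measurable_fun setT phi.
  by apply: measurable_sum => i; exact: measurableT_comp.
pose M w := ereal_sup [set `|G h.1 w - G h.2 w|%:E | h in F_delta F P beta].
apply: (@le_trans _ _ (\int[Q]_w M w)%E); last first.
  by apply: ereal_sup_ubound; exists d', S, Q, G.
have rhole f : F f -> (forall i : 'I_k'.+1, f (y i) ^+ 2 <= beta ^+ 2) ->
    F_delta F P beta (f, f0).
  move=> Ff fb; split => //=; rewrite /rho.
  have mB : measurable_fun setT (fun x => f x - f0 x).
    by apply: measurable_funB; exact: mF.
  rewrite !Rintegral_uniform_points//; last exact: measurable_funX.
  have -> : beta = Num.sqrt (beta ^+ 2) by rewrite sqrtr_sqr gtr0_norm.
  apply: ler_wsqrtr; apply: (@le_trans _ _ (k'.+1%:R^-1 * \sum_(i < k'.+1) beta ^+ 2)).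
    rewrite lerBlDr ler_wpDr ?sqr_ge0// ler_wpM2l ?invr_ge0//.
    by apply: ler_sum => i _; rewrite f0y mulr0 subr0.
  by rewrite sumr_const card_ord -[X in _ * X]mulr_natl mulKf// pnatr_eq0.
have M0 w : (0 <= M w)%E.
  apply: (@le_trans _ _ `|G f0 w - G f0 w|%:E); first by rewrite lee_fin.
  apply: ereal_sup_ubound; exists (f0, f0) => //.
  by apply: rhole => // i; rewrite f0y mulr0 expr0n /= sqr_ge0.
have [N [mN QN NP]] : {ae Q, forall w, ((phi w)%:E <= M w)%E}.
  have := lin (fun=> 0) f0 Ff0 f0y.
  (* There are finitely many sign patterns, so one null set serves for all of them and the pattern
     may then depend on w. *)
  have : {ae Q, forall w, forall s, G (fs s) w = \sum_i (-1) ^+ s i * G (h i) w}.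
    by apply: filter_forall => s; apply: lin; [exact: (fsP s).1|exact: (fsP s).2].
  apply: filterS2 => w fsw f0w.
  pose s : {ffun 'I_k'.+1 -> bool} := [ffun i => G (h i) w < 0].
  apply: ereal_sup_ubound; exists (fs s, f0) => /=.
    apply: rhole; first exact: (fsP s).1.
    by move=> i; rewrite (fsP s).2 exprMn -exprM mulnC exprM sqrrN !expr1n mulr1.
  congr EFin; rewrite f0w big1 => [|i _]; last by rewrite mul0r.
  rewrite subr0 fsw ger0_norm.
    by apply: eq_bigr => i _; rewrite ffunE; case: ltP => [/ltr0_norm ->|/ger0_norm ->];
      rewrite ?expr1 ?expr0 ?mulN1r ?mul1r.
  by apply: sumr_ge0 => i _; rewrite ffunE; case: ltP; rewrite ?expr1 ?expr0 ?mulN1r ?mul1r ?oppr_ge0// => /ltW.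
have phi0 w : 0 <= phi w by exact: sumr_ge0.
(* [M] may fail to be measurable, so the almost sure bound is made to hold everywhere by cutting
   [phi] off on the null set. *)
apply: (@le_trans _ _ (\int[Q]_w ((phi w)%:E * (\1_(~` N) w)%:E))%E); last first.
  apply: ge0_le_integralT => w; first by rewrite -EFinM lee_fin mulr_ge0// indicE ler0n.
  rewrite indicE; case: (boolP (w \in ~` N)) => [/set_mem wN|_]; last by rewrite mule0.
  by rewrite mule1; apply: contrapT => h'; apply: wN; exact: NP.
have -> : (\int[Q]_w ((phi w)%:E * (\1_(~` N) w)%:E) = \int[Q]_w (phi w)%:E)%E.
  apply: ge0_ae_eq_integral => //.
  - apply: emeasurable_funM; apply/measurable_EFinP => //.
    by apply: measurable_indic; exact: measurableC.
  - exact/measurable_EFinP.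
  - by move=> w _; rewrite -EFinM lee_fin mulr_ge0// indicE ler0n.
  - by move=> w _; rewrite lee_fin.
  exists N; split => // w /= /not_implyP[_ h']; apply: contrapT => wN; apply: h'.
  by rewrite indicE mem_set// mule1.
rewrite /phi; under eq_integral do rewrite -sumEFin.
rewrite ge0_integral_sum//; last by move=> i; apply/measurable_EFinP; exact: measurableT_comp.
have kk : k'.+1%:R != 0 :> R by rewrite pnatr_eq0.
apply: (@le_trans _ _ (\sum_(i < k'.+1) ((28 * k'.+1%:R)^-1 : R)%:E)%E).
  rewrite sumEFin sumr_const card_ord lee_fin -[leRHS]mulr_natr.
  by rewrite le_eqVlt; apply/orP; left; apply/eqP; move: kk; move: (k'.+1%:R) => z z0; field.
apply: lee_sum => i _.
apply: (gaussian_process_first_moment_ge gpG (hP' i).1).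
  by rewrite invr_gt0 mulr_gt0.
rewrite (bridge_cov_uniform_points _ _ (mF _ (hP' i).1) (mF _ (hP' i).1)).
have -> : \sum_(j < k'.+1) h i (y j) * h i (y j) = beta ^+ 2.
  rewrite (bigD1 i)//= !(hP' i).2 eqxx big1 ?addr0 ?mulr1 -?expr2// => j ji.
  by rewrite (hP' i).2 (negbTE ji) !mulr0.
have -> : \sum_(j < k'.+1) h i (y j) = beta.
  rewrite (bigD1 i)//= !(hP' i).2 eqxx big1 ?addr0 ?mulr1// => j ji.
  by rewrite (hP' i).2 (negbTE ji) !mulr0.
rewrite -expr2 exprMn beta2.
have : 2 <= k'.+1%:R :> R.
  by rewrite kE ler_nat (@leq_trans (m.+2 ^ 1)%N)// leq_pexp2l.
move: kk; move: (k'.+1%:R) => z z0 z2.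
have z_gt0 : 0 < z by lra.
have -> : z^-1 * (4 * z)^-1 - z^-1 ^+ 2 * (4 * z)^-1 = (z ^+ 2)^-1 * ((1 - z^-1) / 4).
  by field.
have -> : 96 * (28 * z)^-1 ^+ 2 = (z ^+ 2)^-1 * (6 / 49) by field.
rewrite ler_pM2l ?invr_gt0 ?exprn_gt0//.
have : z^-1 <= 2^-1 by rewrite lef_pV2 ?posrE.
lra.
Qed.

Lemma dual_ball_not_donsker : ~ uniform_donsker F.
Proof.
move=> hD; have [_ _ h3] := hD.
have c0 : (0 < 28^-1%:E :> \bar R)%E by rewrite lte_fin.
have /h3 [e /= e0 he] := open_ereal_lt' c0.
have [m me] := ltr_add_invr e0; rewrite add0r in me.
have [P hP] := mean_modulus_ge m hD.
have m0 : 0 < (2 * m.+2%:R)^-1 :> R by rewrite invr_gt0 mulr_gt0.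
have /he/(_ m0) : ball (0 : R) e (2 * m.+2%:R)^-1.
  rewrite /ball /= sub0r normrN gtr0_norm//; apply: lt_trans me.
  by rewrite ltf_pV2 ?posrE ?mulr_gt0// -natrM ltr_nat; lia.
rewrite /= ltNge => /negP; apply; apply: le_trans hP _.
by apply: ereal_sup_ubound; exists P.
Qed.

End NotDonsker.

(** * Signed sums and type *)

Section OrdinalFunctions.

Definition ffcons (T : finType) n (t : T) (g : {ffun 'I_n -> T}) :
    {ffun 'I_n.+1 -> T} := [ffun i => oapp g t (unlift ord0 i)].

Lemma ffcons0 (T : finType) n (t : T) (g : {ffun 'I_n -> T}) : ffcons t g ord0 = t.
Proof. by rewrite ffunE unlift_none. Qed.

Lemma ffconsS (T : finType) n (t : T) (g : {ffun 'I_n -> T}) i :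
  ffcons t g (lift ord0 i) = g i.
Proof. by rewrite ffunE liftK. Qed.

Lemma sum_ffun_ordS (V : nmodType) (T : finType) n (F : {ffun 'I_n.+1 -> T} -> V) :
  \sum_f F f = \sum_t \sum_(g : {ffun 'I_n -> T}) F (ffcons t g).
Proof.
rewrite pair_big /= (reindex (fun p => ffcons p.1 p.2)) //=.
exists (fun f : {ffun 'I_n.+1 -> T} =>
  (f ord0, [ffun i => f (lift ord0 i)])) => [[t g] _|f _] /=.
  by congr (_, _); [rewrite ffcons0|apply/ffunP => i; rewrite ffunE ffconsS].
apply/ffunP => i; case: (unliftP ord0 i) => [j ->|->].
  by rewrite ffconsS ffunE.
by rewrite ffcons0.
Qed.

Lemma sum_ffun_ord0 (V : nmodType) (T : finType) (F : {ffun 'I_0 -> T} -> V) f0 :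
  \sum_f F f = F f0.
Proof.
rewrite (bigD1 f0)//= big1 ?addr0// => f /eqP ff0; exfalso; apply: ff0.
by apply/ffunP => -[].
Qed.

End OrdinalFunctions.

Section SignMeans.
Context {R : realType} {X : normedModType R}.
Implicit Types (s t : seq X) (phi psi : X -> R).

(** The mean of phi over all signed sums of the list, one sign at a time: conditioning on some of
    the signs amounts to unfolding. *)
Fixpoint sign_mean s phi : R :=
  if s is x :: s' then
    (sign_mean s' (fun v => phi (v + x)) + sign_mean s' (fun v => phi (v - x))) / 2
  else phi 0.

Lemma sign_meanE n (x : 'I_n -> X) phi :
  (\sum_(s : {ffun 'I_n -> bool}) phi (\sum_(i < n) (-1) ^+ s i *: x i)) / 2 ^+ n =
  sign_mean [seq x i | i <- enum 'I_n] phi.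
Proof.
elim: n x phi => [|n IH] x phi.
  have e0 : 'I_0 -> bool by case.
  rewrite (sum_ffun_ord0 _ [ffun i => e0 i]) big_ord0 expr0 divr1.
  by rewrite (_ : enum 'I_0 = [::])//; apply: size0nil; rewrite size_enum_ord.
rewrite enum_ordSl /= -map_comp -!IH sum_ffun_ordS big_bool /=.
rewrite -mulrDl exprSr invfM mulrA addrC; congr (_ / _ / _); congr (_ + _);
  apply: eq_bigr => g _; congr phi; rewrite big_ord_recl ffcons0 ?expr0 ?expr1;
  rewrite ?scale1r ?scaleN1r addrC; congr (_ + _);
  by apply: eq_bigr => i _; rewrite ffconsS.
Qed.

Lemma le_sign_mean s phi psi : (forall v, phi v <= psi v) ->
  sign_mean s phi <= sign_mean s psi.
Proof.
elim: s phi psi => [|x s IH] phi psi h /=; first exact: h.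
by rewrite ler_pM2r// lerD// IH.
Qed.

Lemma sign_meanD s phi psi :
  sign_mean s (fun v => phi v + psi v) = sign_mean s phi + sign_mean s psi.
Proof. by elim: s phi psi => [|x s IH] phi psi //=; rewrite !IH; field. Qed.

Lemma sign_meanZ s a phi :
  sign_mean s (fun v => a * phi v) = a * sign_mean s phi.
Proof. by elim: s phi => [|x s IH] phi //=; rewrite !IH; field. Qed.

Lemma sign_mean_cst s a : sign_mean s (fun=> a) = a.
Proof. by elim: s => [|x s IH] //=; rewrite !IH; field. Qed.

Lemma sign_mean0 s phi : sign_mean (0 :: s) phi = sign_mean s phi.
Proof.
rewrite /=; under [X in sign_mean _ X + _]funext do rewrite addr0.
by under [X in _ + sign_mean _ X]funext do rewrite subr0; field.
Qed.

Lemma sign_mean_filter0 s phi : sign_mean [seq v <- s | v != 0] phi = sign_mean s phi.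
Proof.
elim: s phi => [|x s IH] phi //=; have [->|_] /= := eqVneq x 0; last by rewrite !IH.
by rewrite -/(sign_mean (0 :: s) phi) sign_mean0.
Qed.

Lemma sign_mean_nseq0 n s phi : sign_mean (nseq n 0 ++ s) phi = sign_mean s phi.
Proof. by elim: n => [|n IH] //; rewrite [LHS]sign_mean0. Qed.

Lemma sign_mean_opp s phi : sign_mean s (fun v => phi (- v)) = sign_mean s phi.
Proof.
elim: s phi => [|x s IH] phi /=; first by rewrite oppr0.
rewrite addrC -(IH (fun v => phi (v + x))) -(IH (fun v => phi (v - x))).
by congr ((sign_mean s _ + sign_mean s _) / 2); apply/funext => v; rewrite opprD ?opprK.
Qed.

Lemma sign_mean_cat s t phi :
  sign_mean (s ++ t) phi = sign_mean s (fun u => sign_mean t (fun v => phi (v + u))).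
Proof.
elim: s phi => [|x s IH] phi /=.
  by congr sign_mean; apply/funext => v; rewrite addr0.
by rewrite !IH; congr ((sign_mean s _ + sign_mean s _) / 2);
  apply/funext => u; congr sign_mean; apply/funext => v; rewrite addrA.
Qed.

Lemma sqr_sign_mean_le s phi : sign_mean s phi ^+ 2 <= sign_mean s (fun v => phi v ^+ 2).
Proof.
set m := sign_mean s phi.
have : sign_mean s (fun=> 0) <= sign_mean s (fun v => (phi v - m) ^+ 2).
  by apply: le_sign_mean => v; exact: sqr_ge0.
rewrite sign_mean_cst.
have -> : (fun v => (phi v - m) ^+ 2) =
    (fun v => phi v ^+ 2 + ((- (2 * m)) * phi v + m ^+ 2)).
  by apply/funext => v; ring.
by rewrite !sign_meanD sign_meanZ sign_mean_cst -/m; lra.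
Qed.

Implicit Types (ss : seq (seq X)) (f g : seq X -> R).

(** The mean of f at the list of the signed sums of the blocks, all signs being independent. *)
Fixpoint block_mean ss f : R :=
  if ss is s :: ss' then
    sign_mean s (fun u => block_mean ss' (fun us => f (u :: us)))
  else f [::].

Lemma block_meanD ss f g :
  block_mean ss (fun us => f us + g us) = block_mean ss f + block_mean ss g.
Proof.
elim: ss f g => [|s ss IH] f g //=; rewrite -sign_meanD.
by congr sign_mean; apply/funext => u; rewrite IH.
Qed.

Lemma block_meanZ ss a f :
  block_mean ss (fun us => a * f us) = a * block_mean ss f.
Proof.
elim: ss f => [|s ss IH] f //=; rewrite -sign_meanZ.
by congr sign_mean; apply/funext => u; rewrite IH.
Qed.

Lemma block_mean_cst ss a : block_mean ss (fun=> a) = a.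
Proof.
elim: ss => [|s ss IH] //=; rewrite -[RHS](sign_mean_cst s).
by congr sign_mean; apply/funext => u; rewrite IH.
Qed.

Lemma le_block_mean ss f g :
  (forall us, size us = size ss -> f us <= g us) ->
  block_mean ss f <= block_mean ss g.
Proof.
elim: ss f g => [|s ss IH] f g h /=; first exact: h.
by apply: le_sign_mean => u; apply: IH => us usE; apply: h; rewrite /= usE.
Qed.

Lemma block_mean_sum ss phi :
  block_mean ss (fun us => \sum_(u <- us) phi u) = \sum_(s <- ss) sign_mean s phi.
Proof.
elim: ss => [|s ss IH] /=; first by rewrite !big_nil.
rewrite big_cons -IH -[X in _ + X](sign_mean_cst s) -sign_meanD.
congr sign_mean; apply/funext => u.
under [X in block_mean _ X]funext do rewrite big_cons.
by rewrite block_meanD block_mean_cst.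
Qed.

(* Independent extra signs in front of the blocks do not change the law. *)
Lemma sign_mean_flatten ss phi :
  sign_mean (flatten ss) phi = block_mean ss (fun us => sign_mean us phi).
Proof.
elim: ss phi => [|s ss IH] phi //=; rewrite sign_mean_cat.
have E (psi1 psi2 : seq X -> R) : block_mean ss (fun us => (psi1 us + psi2 us) / 2) =
    (block_mean ss psi1 + block_mean ss psi2) / 2.
  rewrite -block_meanD mulrC -block_meanZ.
  by congr block_mean; apply/funext => us; rewrite mulrC.
pose K u := block_mean ss (fun us => sign_mean us (fun v => phi (v + u))).
transitivity (sign_mean s (fun u => 2^-1 * K u + 2^-1 * K (- u))).
  rewrite sign_meanD !sign_meanZ sign_mean_opp.
  have -> : sign_mean s K = sign_mean s (fun u => sign_mean (flatten ss) (fun v => phi (v + u))).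
    by congr sign_mean; apply/funext => u; rewrite IH.
  by field.
by congr sign_mean; apply/funext => u; rewrite E /K; field.
Qed.

Definition sqr_norm (v : X) : R := `|v| ^+ 2.

(** [a] bounds the square of the type 2 constant on n vectors. Cauchy-Schwarz always allows a = n;
    only a smaller value carries information. *)
Definition sqr_type_bound n (a : R) : Prop :=
  forall s, size s = n -> sign_mean s sqr_norm <= a * \sum_(v <- s) sqr_norm v.

(** For fixed signs inside n blocks of length m, the bound for n applies to the block sums; the
    bound for m then applies within each block. *)
Lemma sqr_type_boundM n m a b : 0 <= a ->
  sqr_type_bound n a -> sqr_type_bound m b -> sqr_type_bound (n * m) (a * b).
Proof.
move=> a0 Ha Hb s sE.
have shE : sumn (nseq n m) = size s by rewrite sumn_nseq mulnC.
rewrite -(reshapeKr (_ : size s <= sumn (nseq n m))%N) ?shE//.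
set ss := reshape _ _.
have ssm t : t \in ss -> size t = m.
  move=> /(map_f size); rewrite -/(shape ss) reshapeKl ?shE//.
  by rewrite mem_nseq => /andP[_ /eqP].
have ssn : size ss = n by rewrite size_reshape size_nseq.
rewrite sign_mean_flatten.
apply: (@le_trans _ _ (block_mean ss (fun us => a * \sum_(u <- us) sqr_norm u))).
  by apply: le_block_mean => us usE; apply: Ha; rewrite usE.
rewrite block_meanZ block_mean_sum -mulrA ler_wpM2l// big_flatten /= mulr_sumr.
by rewrite !big_seq; apply: ler_sum => t tss; apply: Hb; exact: ssm.
Qed.

Lemma sqr_type_bound1 : sqr_type_bound 1 1.
Proof.
case=> [|x []]// _; rewrite /= /sqr_norm !add0r normrN big_seq1 mul1r.
by move: (_ ^+ 2) => z; lra.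
Qed.

Lemma sqr_type_boundX n a k : 0 <= a -> sqr_type_bound n a ->
  sqr_type_bound (n ^ k) (a ^+ k).
Proof.
move=> a0 H; elim: k => [|k IH]; first exact: sqr_type_bound1.
by rewrite expnS exprS; exact: sqr_type_boundM.
Qed.

Lemma sqr_type_bound_le n m a : (m <= n)%N -> sqr_type_bound n a -> sqr_type_bound m a.
Proof.
move=> mn H s sE; rewrite -(sign_mean_nseq0 (n - m)); apply: le_trans (H _ _) _.
  by rewrite size_cat size_nseq sE subnK.
by rewrite big_cat /= big_nseq {1}/sqr_norm normr0 expr0n iter_addr_0 mul0rn add0r.
Qed.

End SignMeans.

(** * From a gap in the signed sums to a gain over Cauchy-Schwarz *)

Section TypeFromGap.
Context {R : realType} {X : normedModType R}.

Lemma norm_sign_sum_le n (x : 'I_n -> X) (s : {ffun 'I_n -> bool}) :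
  `|\sum_i (-1) ^+ s i *: x i| <= \sum_i `|x i|.
Proof.
apply: le_trans (ler_norm_sum _ _ _) _; apply: ler_sum => i _.
by rewrite normrZ normrX normrN1 expr1n mul1r.
Qed.

(* Either one sign pattern loses a fixed proportion of the sum of the norms, or
   the norms are so unequal that Cauchy-Schwarz is not sharp. *)
Lemma sqr_type_bound_of_gap n (eta : R) : (0 < n)%N -> 0 < eta <= 1 ->
  (forall x : 'I_n -> X, (forall i, `|x i| <= 1) ->
    exists s : {ffun 'I_n -> bool},
      `|\sum_i (-1) ^+ s i *: x i| <= n%:R * (1 - eta)) ->
  exists2 theta : R, 0 <= theta < 1 & @sqr_type_bound R X n (theta * n%:R).
Proof.
move=> n0 /andP[eta0 eta1] gap.
have nR : 1 <= n%:R :> R by rewrite ler1n.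
pose delta : R := (2 ^+ n)^-1.
have p1 : 1 <= 2 ^+ n :> R by rewrite exprn_ege1// ler1n.
have delta0 : 0 < delta by rewrite invr_gt0; lra.
have delta1 : delta <= 1 by rewrite invf_le1; lra.
(* [delta] is the weight of a single sign pattern, and [kap] lies below the gains of both cases:
   delta eta / 2 for nearly equal norms, eta^2 / (4 n) for unequal ones. *)
pose kap := delta * (eta ^+ 2 / (4 * n%:R)).
have e1 : eta ^+ 2 / (4 * n%:R) <= eta / 2.
  by rewrite ler_pdivrMr; [nra|lra].
have e0 : 0 < eta ^+ 2 / (4 * n%:R) by rewrite divr_gt0 ?exprn_gt0//; lra.
have kap0 : 0 < kap by rewrite /kap mulr_gt0.
have kap1 : kap < 1 by rewrite /kap; nra.
exists (1 - kap); first by apply/andP; split; lra.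
move=> us usE.
pose x (i : 'I_n) := nth 0 us i.
have -> : us = [seq x i | i <- enum 'I_n].
  by rewrite /x (map_comp (nth 0 us) val) val_enum_ord -usE map_nth_iota0 ?take_size.
rewrite -sign_meanE /sqr_norm.
pose a i := `|x i|; set A := \sum_i a i.
have A0 : 0 <= A by apply: sumr_ge0 => i _; exact: normr_ge0.
have -> : \sum_(v <- [seq x i | i <- enum 'I_n]) `|v| ^+ 2 = \sum_i a i ^+ 2.
  by rewrite big_map big_enum.
set D := \sum_i a i ^+ 2.
have D0 : 0 <= D by apply: sumr_ge0 => i _; exact: sqr_ge0.
have varE : n%:R * D - A ^+ 2 = n%:R * \sum_i (a i - A / n%:R) ^+ 2.
  have -> : \sum_i (a i - A / n%:R) ^+ 2 =
      \sum_i (a i ^+ 2 + (- 2 * (A / n%:R) * a i + (A / n%:R) ^+ 2)).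
    by apply: eq_bigr => i _; ring.
  rewrite !big_split /= -mulr_sumr -/A sumr_const card_ord -(mulr_natr ((A / n%:R) ^+ 2)).
  have n_neq0 : n%:R != 0 :> R by rewrite gt_eqF//; lra.
  by rewrite -/D; move: (n%:R) n_neq0 => z z0; field.
have var0 : A ^+ 2 <= n%:R * D.
  rewrite -subr_ge0 varE mulr_ge0// ?ler0n// sumr_ge0// => i _; exact: sqr_ge0.
have [i0 imax] : exists i0, forall i, a i <= a i0.
  by case: (arg_maxP a (isT : xpredT (Ordinal n0))) => i _ h; exists i => j; exact: h.
set M := a i0 in imax.
have M0 : 0 <= M by exact: normr_ge0.
have DM : D <= n%:R * M ^+ 2.
  rewrite mulr_natl -[X in _ *+ X](card_ord n) -sumr_const; apply: ler_sum => i _.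
  by apply: lerXn2r; [exact: normr_ge0|exact: M0|exact: imax].
pose N (s : {ffun 'I_n -> bool}) := `|\sum_i (-1) ^+ s i *: x i|.
have NA s : N s ^+ 2 <= A ^+ 2.
  by apply: lerXn2r; [exact: normr_ge0|exact: A0|exact: norm_sign_sum_le].
have cardS : #|{: {ffun 'I_n -> bool}}|%:R = 2 ^+ n :> R.
  by rewrite card_ffun card_bool card_ord natrX.
have total s0 : (\sum_s N s ^+ 2) / 2 ^+ n <= A ^+ 2 - delta * (A ^+ 2 - N s0 ^+ 2).
  rewrite ler_pdivrMr; last lra.
  have -> : (A ^+ 2 - delta * (A ^+ 2 - N s0 ^+ 2)) * 2 ^+ n =
      A ^+ 2 * 2 ^+ n - (A ^+ 2 - N s0 ^+ 2).
    by rewrite /delta; field; rewrite expf_neq0.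
  rewrite -cardS mulr_natr -sumr_const (bigD1 s0)//= [in leRHS](bigD1 s0)//=.
  have : \sum_(s | s != s0) N s ^+ 2 <= \sum_(s | s != s0) A ^+ 2 by exact: ler_sum.
  by move: (\sum_(s | s != s0) N s ^+ 2) (\sum_(s | s != s0) A ^+ 2) => u v; lra.
rewrite -mulrA.
have [ME|Mn0] := eqVneq M 0.
  have A_0 : A = 0.
    apply/eqP; rewrite eq_le A0 andbT; apply: sumr_le0 => i _.
    by rewrite -ME; exact: imax.
  apply: le_trans (total [ffun=> false]) _; rewrite A_0 expr0n /=.
  have := NA [ffun=> false]; rewrite A_0 expr0n /= => h.
  apply: (@le_trans _ _ 0); first by have := sqr_ge0 (N [ffun=> false]); nra.
  by apply: mulr_ge0; [lra|apply: mulr_ge0; [lra|]].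
have M_gt0 : 0 < M by rewrite lt0r Mn0.
have [|s0 hs0] := gap (fun i => M^-1 *: x i).
  move=> i; rewrite normrZ gtr0_norm ?invr_gt0// mulrC ler_pdivrMr// mul1r.
  exact: imax.
have Ns0 : N s0 <= M * (n%:R * (1 - eta)).
  have E : \sum_i (-1) ^+ s0 i *: (M^-1 *: x i) = M^-1 *: \sum_i (-1) ^+ s0 i *: x i.
    by rewrite scaler_sumr; apply: eq_bigr => i _; rewrite !scalerA mulrC.
  by move: hs0; rewrite E normrZ gtr0_norm ?invr_gt0// ler_pdivrMl.
apply: le_trans (total s0) _.
have N0 : 0 <= N s0 by exact: normr_ge0.
(* If A >= (1 - eta/2) n M, the pattern [s0] loses a factor 1 - eta/2 against [A]. Otherwise the
   largest norm exceeds the average by M eta / 2, which [varE] turns into a loss in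
   Cauchy-Schwarz. *)
have [hA|hA] := leP ((1 - eta / 2) * (n%:R * M)) A.
  have h1 : N s0 <= A * (1 - eta / 2).
    apply: le_trans Ns0 _.
    have nM : 0 <= n%:R * M by rewrite mulr_ge0//; lra.
    have : 0 <= (1 - eta / 2) by lra.
    move: hA; have -> : M * (n%:R * (1 - eta)) = (n%:R * M) * (1 - eta) by ring.
    by move: (n%:R * M) nM => z z0 hA q; nra.
  have h2 : N s0 ^+ 2 <= A ^+ 2 * (1 - eta / 2).
    apply: (@le_trans _ _ ((A * (1 - eta / 2)) ^+ 2)).
      by rewrite ler_pXn2r ?nnegrE// mulr_ge0//; lra.
    by rewrite exprMn ler_wpM2l ?sqr_ge0// expr2; nra.
  have h3 : A ^+ 2 - delta * (A ^+ 2 - N s0 ^+ 2) <= A ^+ 2 * (1 - delta * (eta / 2)).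
    by have := sqr_ge0 A; nra.
  apply: le_trans h3 _; have k1 : kap <= delta * (eta / 2) by rewrite /kap ler_pM2l.
  have := sqr_ge0 A; have : delta * (eta / 2) <= 1 by nra.
  by nra.
have h4 : A ^+ 2 <= n%:R * D * (1 - eta ^+ 2 / (4 * n%:R)).
  have h5 : n%:R * (M * (eta / 2)) ^+ 2 <= n%:R * D - A ^+ 2.
    rewrite varE ler_pM2l; last lra.
    rewrite (bigD1 i0)//= -/M; apply: ler_wpDr.
      by apply: sumr_ge0 => i _; exact: sqr_ge0.
    have h6 : M * (eta / 2) <= M - A / n%:R.
      suff : A / n%:R <= (1 - eta / 2) * M by lra.
      by rewrite ler_pdivrMr; [lra|lra].
    rewrite ler_pXn2r ?nnegrE//; first by rewrite mulr_ge0//; lra.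
    by apply: le_trans h6; rewrite mulr_ge0//; lra.
  have -> : n%:R * D * (1 - eta ^+ 2 / (4 * n%:R)) = n%:R * D - D * eta ^+ 2 / 4.
    by field; rewrite gt_eqF//; lra.
  suff : D * eta ^+ 2 / 4 <= n%:R * (M * (eta / 2)) ^+ 2 by lra.
  have -> : n%:R * (M * (eta / 2)) ^+ 2 = (n%:R * M ^+ 2) * eta ^+ 2 / 4 by field.
  by rewrite ler_pM2r// ler_pM2r// exprn_gt0.
have h7 : A ^+ 2 - delta * (A ^+ 2 - N s0 ^+ 2) <= A ^+ 2 by have := NA s0; nra.
apply: le_trans h7 _; apply: le_trans h4 _; rewrite mulrC ler_wpM2r//.
  by rewrite mulr_ge0//; lra.
by rewrite lerB// /kap; nra.
Qed.

End TypeFromGap.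

(** * From the square bound to a power bound on Rademacher means *)

Section TypeFromSquareBound.
Context {R : realType} {X : normedModType R}.

Lemma rademacher_meanE n (x : 'I_n -> X) :
  rademacher_mean x = sign_mean [seq x i | i <- enum 'I_n] Num.norm.
Proof. by rewrite -sign_meanE. Qed.

Lemma rademacher_meanD n (x y : 'I_n -> X) :
  rademacher_mean (fun i => x i + y i) <= rademacher_mean x + rademacher_mean y.
Proof.
rewrite /rademacher_mean -mulrDl ler_pM2r ?invr_gt0 ?exprn_gt0// -big_split.
apply: ler_sum => s _; apply: le_trans (ler_normD _ _).
by rewrite -big_split /=; under eq_bigr do rewrite scalerDr.
Qed.

Lemma rademacher_meanZ n (x : 'I_n -> X) (a : R) : 0 <= a ->
  rademacher_mean (fun i => a *: x i) = a * rademacher_mean x.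
Proof.
move=> a0; rewrite /rademacher_mean mulrA mulr_sumr; congr (_ / _).
apply: eq_bigr => s _; rewrite -[X in X * _](ger0_norm a0) -normrZ scaler_sumr.
by congr `|_|; apply: eq_bigr => i _; rewrite !scalerA mulrC.
Qed.

Lemma sqr_type_bound_mono n (a b : R) : a <= b ->
  @sqr_type_bound R X n a -> @sqr_type_bound R X n b.
Proof.
move=> ab H s sE; apply: le_trans (H s sE) _; apply: ler_wpM2r => //.
by apply: sumr_ge0 => v _; exact: sqr_ge0.
Qed.

Lemma expn_between n M : (1 < n)%N -> (0 < M)%N ->
  exists k, (M <= n ^ k <= n * M)%N.
Proof.
move=> n1 M0; have [->|M1] := eqVneq M 1%N.
  by exists 0%N; rewrite expn0 muln1 leqnn ltnW.
have {}M1 : (1 < M)%N by rewrite ltn_neqAle eq_sym M1.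
exists (up_log n M); have /andP[h1 h2] := up_log_bounds n1 M1.
rewrite h2 /=; have k0 : (0 < up_log n M)%N by rewrite up_log_gt0 n1 M1.
by rewrite -(prednK k0) expnS leq_mul2l ltnW ?orbT.
Qed.

(** Padding the nonzero vectors with zeros up to n^k bounds the second moment by (theta n)^k n^k =
    c^k, where c = theta n^2, and alpha is defined by n^(2 alpha) = c. Rounding up to a power of n
    costs at most the factor n^alpha. The dyadic decomposition needs the count of the nonzero
    vectors on the right, not N. *)
Lemma rademacher_mean_power_bound n (theta : R) : (1 < n)%N -> 0 <= theta < 1 ->
  @sqr_type_bound R X n (theta * n%:R) ->
  exists alpha C : R, [/\ 0 < alpha < 1, 0 <= C &
    forall N (x : 'I_N -> X), (forall i, `|x i| <= 1) ->
      rademacher_mean x <= C * (\sum_i (x i != 0)%:R) `^ alpha].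
Proof.
move=> n1 /andP[th0 th1].
(* Then c >= 2, which makes alpha positive. *)
wlog th2 : theta th0 th1 / 2^-1 <= theta.
  move=> W H; apply: (W (Num.max theta 2^-1)).
  - by rewrite le_max th0.
  - by rewrite gt_max th1/=; lra.
  - by rewrite le_max lexx orbT.
  - by apply: sqr_type_bound_mono H; rewrite ler_wpM2r// le_max lexx.
move=> H.
have nR : 2 <= n%:R :> R by rewrite ler_nat.
pose c := theta * n%:R ^+ 2.
have c1 : 1 < c by rewrite /c expr2; nra.
have cn : c < n%:R ^+ 2 by rewrite /c gtr_pMl ?exprn_gt0//; lra.
have lnn : 0 < ln n%:R :> R by rewrite ln_gt0; lra.
pose alpha := ln c / (2 * ln n%:R).
have alpha0 : 0 < alpha by rewrite divr_gt0 ?ln_gt0 ?mulr_gt0.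
have alpha1 : alpha < 1.
  rewrite ltr_pdivrMr ?mulr_gt0// mul1r mulr_natl -lnXn; last by lra.
  by rewrite ltr_ln// posrE ?exprn_gt0//; lra.
have powE k : ((n ^ k)%:R `^ alpha) ^+ 2 = c ^+ k :> R.
  have nk : 0 < (n ^ k)%:R :> R by rewrite ltr0n expn_gt0 ltnW.
  rewrite /powR gt_eqF// -expRM_natl natrX lnXn; last lra.
  rewrite -[in RHS](@lnK _ c) ?posrE; last lra.
  rewrite -expRM_natl; congr expR; rewrite /alpha -(mulr_natr (ln n%:R)).
  by move: (ln n%:R) lnn => z z0; field; rewrite gt_eqF.
exists alpha, (n%:R `^ alpha); split; [by rewrite alpha0| exact: powR_ge0|].
move=> N x x1; set s := [seq v <- [seq x i | i <- enum 'I_N] | v != 0].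
have -> : \sum_i (x i != 0)%:R = (size s)%:R :> R.
  rewrite /s size_filter count_map -sum1_count natr_sum [RHS]big_mkcond [RHS]big_enum /=.
  by apply: eq_bigr => i _ /=; case: ifP.
rewrite rademacher_meanE -sign_mean_filter0 -/s.
have [s0|s_gt0] := posnP (size s).
  by rewrite (size0nil s0) /= normr0 mulr_ge0 ?powR_ge0.
have [k /andP[sk kn]] := expn_between n1 s_gt0.
have Hk : @sqr_type_bound R X (size s) ((theta * n%:R) ^+ k).
  apply: (sqr_type_bound_le sk); apply: sqr_type_boundX => //.
  by rewrite mulr_ge0//; lra.
have Enorm0 : 0 <= sign_mean s Num.norm.
  rewrite -[X in X <= _](sign_mean_cst s 0); exact: le_sign_mean.
apply: (@le_trans _ _ ((n ^ k)%:R `^ alpha)).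
  rewrite -(@ler_pXn2r _ 2) ?nnegrE ?powR_ge0// powE.
  apply: le_trans (sqr_sign_mean_le _ _) _.
  apply: le_trans (Hk _ erefl) _.
  have -> : c ^+ k = (theta * n%:R) ^+ k * (n ^ k)%:R.
    by rewrite natrX -exprMn /c expr2 mulrA.
  rewrite ler_wpM2l ?exprn_ge0 ?mulr_ge0//.
  apply: (@le_trans _ _ (\sum_(v <- s) 1)).
    rewrite !big_seq; apply: ler_sum => v; rewrite mem_filter => /andP[_ /mapP[i _ ->]].
    by rewrite /sqr_norm -(expr1n _ 2) ler_pXn2r ?nnegrE.
  by rewrite big_const_seq count_predT iter_addr_0 ler_nat.
by rewrite -powRM// -natrM ge0_ler_powR ?nnegrE ?ler_nat// ltW.
Qed.

End TypeFromSquareBound.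

Section TypeFromPowerBound.
Context {R : realType} {X : normedModType R}.
Variables (alpha C : R).
Hypotheses (alpha01 : 0 < alpha < 1) (C0 : 0 <= C).
Hypothesis power_bound : forall N (x : 'I_N -> X), (forall i, `|x i| <= 1) ->
  rademacher_mean x <= C * (\sum_i (x i != 0)%:R) `^ alpha.


(** The harmonic mean of 1 and 1 / alpha, so that p > 1 and p alpha < 1. Hence r < 2, and [K] can be
    the fixed point of the recursion K = C r + K r / 2 of the dyadic argument. *)
Let p : R := 2 / (1 + alpha).
Let r : R := 2 `^ (p * alpha).
Let K : R := C * r / (1 - r / 2).

Let p1 : 1 < p.
Proof. by have /andP[a0 a1] := alpha01; rewrite /p ltr_pdivlMr; lra. Qed.

Let r2 : r < 2.
Proof.
have /andP[a0 a1] := alpha01.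
have pa : p * alpha < 1 by rewrite /p mulrAC ltr_pdivrMr; lra.
rewrite /r /powR pnatr_eq0 /= -[ltRHS](@lnK _ 2) ?posrE// ltr_expR.
by rewrite gtr_pMl// ln_gt0//; lra.
Qed.

Let r0 : 0 <= r. Proof. exact: powR_ge0. Qed.

Let K0 : 0 <= K.
Proof. by rewrite /K divr_ge0 ?mulr_ge0//; have := r2; lra. Qed.

Let KE : C * r + 2^-1 * (K * r) = K.
Proof.
have h : 1 - r / 2 != 0 by rewrite gt_eqF//; have := r2; lra.
rewrite /K; move: h; move: r => z h; field.
by apply: contra_neq h => h; lra.
Qed.

(* Splitting off the vectors of norm above 1/2 and doubling the others. *)
Lemma rademacher_mean_dyadic J N (x : 'I_N -> X) (A : R) :
  (forall i, `|x i| <= 1) -> (forall i, x i = 0 \/ 2 ^- J < `|x i|) ->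
  \sum_i `|x i| `^ p <= A -> rademacher_mean x <= K * A `^ alpha.
Proof.
have /andP[a0 a1] := alpha01; have p0 : 0 < p by have := p1; lra.
have p0' := ltW p0; have a0' := ltW a0.
elim: J N x A => [|J IH] N x A x1 xJ xA.
  have x0 i : x i = 0.
    by case: (xJ i) => //; rewrite expr0 invr1 ltNge x1.
  have -> : x = (fun i => 0 *: x i) by apply/funext => i; rewrite scale0r.
  by rewrite rademacher_meanZ// mul0r mulr_ge0// powR_ge0.
have A0 : 0 <= A by apply: le_trans xA; apply: sumr_ge0 => i _; exact: powR_ge0.
pose big i := 2^-1 < `|x i|.
pose y i := if big i then x i else 0.
pose z i := if big i then 0 else x i.
have -> : x = (fun i => y i + z i).
  by apply/funext => i; rewrite /y /z; case: ifP; rewrite ?addr0 ?add0r.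
apply: le_trans (rademacher_meanD _ _) _.
have dbl (u : X) : `|2 *: u| = 2 * `|u| by rewrite normrZ ger0_norm.
(* Both halves see the sum 2^p A: it bounds the number of vectors of norm above 1/2, and it bounds
   the p-sum of the doubled small ones. *)
have scaleA : (2 `^ p * A) `^ alpha = r * A `^ alpha.
  by rewrite powRM ?powR_ge0// /r powRrM.
have hy : rademacher_mean y <= C * (r * A `^ alpha).
  have y1 i : `|y i| <= 1 by rewrite /y; case: ifP; rewrite ?normr0.
  apply: le_trans (power_bound y1) _; rewrite ler_wpM2l// -scaleA.
  have S0 : 0 <= \sum_i (y i != 0)%:R :> R by apply: sumr_ge0 => i _; rewrite ler0n.
  apply: (ge0_ler_powR a0'); rewrite ?nnegrE//; first by rewrite mulr_ge0 ?powR_ge0.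
  apply: (@le_trans _ _ (\sum_i 2 `^ p * `|x i| `^ p)); last first.
    by rewrite -mulr_sumr ler_wpM2l// powR_ge0.
  apply: ler_sum => i _; rewrite -powRM// /y /big.
  case: ifP => [h|_]; last by rewrite eqxx powR_ge0.
  apply: (@le_trans _ _ 1); first by case: eqP => //= _; rewrite ler01.
  apply: (@le_trans _ _ (1 `^ p)); first by rewrite powR1.
  by apply: (ge0_ler_powR p0'); rewrite ?nnegrE//; lra.
have hz : rademacher_mean z <= 2^-1 * (K * (r * A `^ alpha)).
  have -> : z = (fun i => 2^-1 *: (2 *: z i)).
    by apply/funext => i; rewrite scalerA mulVf// scale1r.
  rewrite rademacher_meanZ// ler_wpM2l// -scaleA; apply: IH.
  - move=> i; rewrite dbl /z /big; case: ltP => h; rewrite ?normr0; lra.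
  - move=> i; rewrite /z; case: ifP => _; first by left; rewrite scaler0.
    case: (xJ i) => [->|h]; [by left; rewrite scaler0|right].
    rewrite dbl; move: h; rewrite exprSr invfM; set w := 2 ^- J; lra.
  - apply: (@le_trans _ _ (\sum_i 2 `^ p * `|x i| `^ p)); last first.
      by rewrite -mulr_sumr ler_wpM2l// powR_ge0.
    apply: ler_sum => i _; rewrite dbl powRM// ler_wpM2l ?powR_ge0//.
    by rewrite /z; case: ifP => // _; rewrite normr0 powR0 ?powR_ge0 ?gt_eqF.
apply: le_trans (lerD hy hz) _; rewrite -[X in _ <= X * _]KE mulrDl.
by rewrite !mulrA.
Qed.

(** By homogeneity the p-sum may be taken equal to 1, where the exponents alpha and 1 / p give the
    same bound. *)
Lemma has_type_of_power_bound : nontrivial_type X.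
Proof.
have p0 : 0 < p by have := p1; lra.
have tp : has_type X p.
  split => //; exists K => N x.
  set T := \sum_i `|x i| `^ p.
  have T0 : 0 <= T by apply: sumr_ge0 => i _; exact: powR_ge0.
  have [TE|Tn0] := eqVneq T 0.
    have x0 i : x i = 0.
      apply/eqP; rewrite -normr_eq0; apply/eqP/(@powR_injective _ p p0);
        rewrite ?nnegrE// powR0 ?gt_eqF//.
      apply/eqP; rewrite eq_le powR_ge0 andbT -TE /T (bigD1 i)//= lerDl.
      by apply: sumr_ge0 => j _; exact: powR_ge0.
    have -> : x = (fun i => 0 *: x i) by apply/funext => i; rewrite scale0r.
    by rewrite rademacher_meanZ// mul0r mulr_ge0// powR_ge0.
  have T_gt0 : 0 < T by rewrite lt0r Tn0.
  set S := T `^ p^-1; have S0 : 0 < S by exact: powR_gt0.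
  have Sp : S `^ p = T by rewrite /S -powRrM mulVf ?gt_eqF// powRr1.
  have -> : x = (fun i => S *: (S^-1 *: x i)).
    by apply/funext => i; rewrite scalerA mulfV ?gt_eqF// scale1r.
  rewrite (rademacher_meanZ _ (ltW S0)) [leLHS]mulrC; apply: ler_wpM2r; first exact: ltW.
  pose u i := S^-1 *: x i; rewrite -/u.
  have un i : `|u i| = `|x i| / S.
    by rewrite normrZ gtr0_norm ?invr_gt0// mulrC.
  have uA : \sum_i `|u i| `^ p <= 1.
    rewrite (eq_bigr (fun i => `|x i| `^ p / T)); last first.
      move=> i _; rewrite un powRM ?invr_ge0 ?(ltW S0)//; congr (_ * _).
      rewrite -(powR_inv1 (ltW S0)) -powRrM mulrC powRrM Sp.
      by rewrite powR_inv1// ltW.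
    by rewrite -mulr_suml -/T mulfV.
  have u1 i : `|u i| <= 1.
    rewrite un ler_pdivrMr// mul1r leNgt; apply/negP => h.
    have : T < `|x i| `^ p.
      by rewrite -Sp; apply: gt0_ltr_powR; rewrite ?nnegrE// ltW.
    rewrite ltNge => /negP; apply; rewrite /T (bigD1 i)//= lerDl.
    by apply: sumr_ge0 => j _; exact: powR_ge0.
  have [J hJ] : exists J, forall i, u i = 0 \/ 2 ^- J < `|u i|.
    have ex i : exists J : nat, u i = 0 \/ 2 ^- J < `|u i|.
      have [->|ui] := eqVneq (u i) 0; first by exists 0%N; left.
      have ui0 : 0 < `|u i| by rewrite normr_gt0.
      have [k] := ltr_add_invr ui0; rewrite add0r => hk.
      exists k.+1; right; apply: le_lt_trans hk.
      rewrite lef_pV2 ?posrE ?exprn_gt0//.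
      by rewrite -natrX ler_nat ltnW// ltn_expl.
    have [f fP] := choice ex; exists (\max_i f i) => i.
    case: (fP i) => [|h]; [by left|right].
    apply: le_lt_trans h; rewrite lef_pV2 ?posrE ?exprn_gt0//.
    by rewrite ler_eXn2l ?leq_bigmax//; lra.
  by have := rademacher_mean_dyadic u1 hJ uA; rewrite (powR1 R) mulr1.
rewrite /nontrivial_type; apply: (@lt_le_trans _ _ p%:E); first by rewrite lte_fin.
by apply: ereal_sup_ubound; exists p.
Qed.

End TypeFromPowerBound.

(** * Type from the Glivenko-Cantelli property *)

Section UniformSample.
Context d (T : measurableType d) (R : realType) (n m : nat) (y : nat -> T).

Let N := #|{: {ffun 'I_m -> 'I_n.+1}}|.-1.
Let J (k : nat) : {ffun 'I_m -> 'I_n.+1} := nth [ffun=> ord0] (enum {: {ffun 'I_m -> 'I_n.+1}}) k.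
Let Q : probability nat R := @uniform_points _ nat R N id.

Let NE : N.+1 = #|{: {ffun 'I_m -> 'I_n.+1}}|.
Proof. by rewrite /N prednK//; apply/card_gt0P; exists [ffun=> ord0]. Qed.

Let QE (A : set nat) : Q A =
  ((\prod_(i < m) n.+1%:R)^-1 * \sum_(k < N.+1) \1_A (k : nat))%:E.
Proof.
rewrite /Q /= uniform_pointsE; congr (_^-1 * _)%:E.
by rewrite NE card_ffun !card_ord natrX prodr_const card_ord.
Qed.

Let sumJ (F : {ffun 'I_m -> 'I_n.+1} -> R) : \sum_(k < N.+1) F (J k) = \sum_f F f.
Proof.
rewrite -[RHS]big_enum /= (big_nth [ffun=> ord0]) -cardE -NE big_mkord.
by [].
Qed.

Let Q_bigcap (A : 'I_m -> set T) :
  Q (\bigcap_(i in [set: 'I_m]) ((fun k => y (J k i)) @^-1` A i)) =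
  (\prod_(i < m) @uniform_points _ T R n y (A i))%E.
Proof.
rewrite QE.
have -> : \sum_(k < N.+1) \1_(\bigcap_(i in [set: 'I_m]) ((fun k => y (J k i)) @^-1` A i)) (k : nat) =
    \sum_(k < N.+1) \prod_i \1_(A i) (y (J k i)) :> R.
  apply: eq_bigr => k _; rewrite indicE.
  case: (boolP (_ \in _)) => [/set_mem h|h].
    by rewrite big1// => i _; rewrite indicE mem_set//; exact: h.
  have [i hi] : exists i, ~ A i (y (J k i)).
    by apply/existsNP => h'; move/negP: h; apply; apply/mem_set => i _; exact: h'.
  by rewrite (bigD1 i)//= indicE memNset// mul0r.
rewrite (sumJ (fun f => \prod_i \1_(A i) (y (f i)))).
rewrite -(bigA_distr_bigA (fun (i : 'I_m) (j : 'I_n.+1) => \1_(A i) (y j))) /=.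
rewrite -prodfV -big_split /=.
by rewrite -prodEFin; apply: eq_bigr => i _; rewrite uniform_pointsE.
Qed.

(** The m-tuples of indices are enumerated by an initial segment of [nat], where all sets are
    measurable. Beyond it the enumeration returns a default tuple, so that every outcome, not just
    almost every one, has its values among the [y j]. *)
Lemma uniform_points_sample : exists (Q : probability nat R)
  (Xs : 'I_m -> {RV Q >-> T}), iid_sample (@uniform_points _ T R n y) Xs /\
  forall i k, exists j : 'I_n.+1, Xs i k = y j.
Proof.
have mX (i : 'I_m) : measurable_fun setT (fun k => y (J k i)) by [].
pose Xs (i : 'I_m) : {RV Q >-> T} :=
  HB.pack (fun k => y (J k i)) (isMeasurableFun.Build _ _ _ _ _ (mX i)).
exists Q, Xs; split; last by move=> i k; exists (J k i).
have marg i A : Q (Xs i @^-1` A) = @uniform_points _ T R n y A.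
  have := Q_bigcap (fun i' => if i' == i then A else setT).
  rewrite (bigD1 i)//= eqxx big1 ?mule1; last first.
    by move=> j ji; rewrite (negbTE ji) probability_setT.
  move=> <-; congr (Q _); apply/seteqP; split => k /=.
    by move=> Ak i' _; case: eqP => // ->.
  by move=> /(_ i I); rewrite eqxx.
split => [i A mA|A mA]; first exact: marg.
by apply: (etrans (Q_bigcap A)); apply: eq_bigr => i _; exact: esym (marg i (A i)).
Qed.

End UniformSample.

Section TypeFromGlivenkoCantelli.
Context {R : realType} {X : completeNormedModType R}.

Lemma norming_functional (v : X) : exists phi : {linear X -> R^o},
  [/\ continuous phi, forall y, `|phi y| <= `|y| & phi v = `|v|].
Proof.
have [|phi [cphi phi1 phiv]] := @helly _ _ 1 (fun=> v) (fun=> `|v|).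
  by move=> a; rewrite !big_ord1 normrZ ler_wpM2r// ler_norm.
by exists phi; split => //; exact: (phiv ord0).
Qed.

(** Without the gap every signed sum of the 4m vectors has norm above 4m - 1/4. Each term being at
    most 1, a functional norming the sum has all its signed values at least 3/4. The deviation then
    occurs at every outcome, hence with probability 1. *)
Lemma sign_gap_of_deviation m : (0 < m)%N ->
  (forall P, separably_supported P ->
     (deviation_prob (@dual_unit_ball R X) P 2^-1 m < 1)%E) ->
  forall x : 'I_(4 * m) -> X, (forall i, `|x i| <= 1) ->
    exists s : {ffun 'I_(4 * m) -> bool},
      `|\sum_i (-1) ^+ s i *: x i| <= (4 * m)%:R * (1 - (4 * (4 * m)%:R)^-1).
Proof.
move=> m0 dev x x1; apply: contrapT => nex.
pose n := (4 * m).-1; have nE : n.+1 = (4 * m)%N by rewrite /n prednK// muln_gt0.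
have nR : (4 * m)%:R != 0 :> R by rewrite pnatr_eq0 muln_eq0 /= -lt0n.
have far (s : {ffun 'I_(4 * m) -> bool}) :
    (4 * m)%:R - 4^-1 < `|\sum_i (-1) ^+ s i *: x i|.
  rewrite ltNge; apply/negP => h; apply: nex; exists s.
  by move: h nR; move: (4 * m)%:R => z h z0; have -> : z * (1 - (4 * z)^-1) = z - 4^-1 by field.
pose y (i : nat) := ball_point (x (insubd (Ordinal (leq_trans (ltn0Sn n) (eq_leq nE))) i)).
pose P : probability (borel_ball X) R := @uniform_points _ (borel_ball X) R n y.
have sepP : separably_supported P.
  pose D : set (set_type (@unit_ball R X)) := [set y i | i in `I_n.+1].
  exists D; split; first exact/finite_set_countable/finite_image.
  transitivity ((n.+1%:R^-1 * \sum_(i < n.+1) (1 : R))%:E).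
    rewrite /P /= uniform_pointsE; congr (_ * _)%:E; apply: eq_bigr => i _.
    rewrite indicE mem_set//; apply: (@subset_closure _ D).
    by exists (i : nat) => //=.
  by rewrite sumr_const card_ord mulVf// nE.
have := dev P sepP; rewrite ltNge => /negP; apply.
have [Q [Xs [iid Xsy]]] := @uniform_points_sample _ (borel_ball X) R n m y.
apply: ereal_sup_ubound; exists _, nat, Q, Xs; split => //.
suff -> : [set w | ((2^-1)%:E <= empirical_deviation (@dual_unit_ball R X) P Xs w)%E] = setT.
  rewrite measurable_mu_extE; last exact: measurableT.
  exact/esym/probability_setT.
apply/seteqP; split => // w _ /=.
have yx (j : 'I_(4 * m)) : ball_val (y j) = x j.
  by rewrite /y ball_pointK// valKd.
have [J XsJ] : exists J : 'I_m -> 'I_(4 * m), forall l, Xs l w = y (J l).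
  have : forall l, exists j : 'I_(4 * m), Xs l w = y j.
    by move=> l; have [j ->] := Xsy l w; exists (cast_ord nE j).
  by move=> /choice[J hJ]; exists J.
(* Sign + on the sampled vectors, at most m of them, and sign - on the others. *)
pose s : {ffun 'I_(4 * m) -> bool} := [ffun j => j \notin codom J].
have [phi [cphi phi1 phiv]] := norming_functional (\sum_i (-1) ^+ s i *: x i).
have big j : 3 / 4 <= (-1) ^+ s j * phi (x j).
  have := far s; rewrite -phiv linear_sum (bigD1 j)//= linearZ /=.
  have le1 i : (-1) ^+ s i *: phi (x i) <= 1.
    apply: le_trans (ler_norm _) _; rewrite normrM normrX normrN1 expr1n mul1r.
    exact: le_trans (phi1 _) (x1 i).
  have : \sum_(i | i != j) phi ((-1) ^+ s i *: x i) <= \sum_(i | i != j) (1 : R).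
    by apply: ler_sum => i _; rewrite linearZ; exact: le1.
  rewrite sumr_const cardC1 card_ord.
  have -> : (4 * m).-1%:R = (4 * m)%:R - 1 :> R by rewrite -subn1 natrB// muln_gt0.
  move: (\sum_(i | i != j) _) => S; rewrite -[(-1) ^+ s j *: phi (x j)]/((-1) ^+ s j * phi (x j)); lra.
have fF := contraction_in_dual_ball cphi phi1.
have mf := dual_unit_ball_measurable fF.
set f := phi \o @ball_val R X in fF mf.
apply: (@le_trans _ _ `|(\int[P]_x0 f x0)%R - m%:R^-1 * \sum_(i < m) f (Xs i w)|%:E);
  last by apply: ereal_sup_ubound; exists f.
rewrite lee_fin Rintegral_uniform_points//.
have mR : 0 < m%:R :> R by rewrite ltr0n.
have emp : 3 / 4 <= m%:R^-1 * \sum_(i < m) f (Xs i w).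
  rewrite [leRHS]mulrC ler_pdivlMr// mulr_natr -[X in _ *+ X](card_ord m) -sumr_const.
  apply: ler_sum => l _; rewrite XsJ /f /= yx.
  by have := big (J l); rewrite ffunE codom_f /= expr0 mul1r.
have mean : n.+1%:R^-1 * \sum_(i < n.+1) f (y i) <= 0.
  rewrite pmulr_rle0 ?invr_gt0//.
  have -> : \sum_(i < n.+1) f (y i) = \sum_(j < 4 * m) f (y j).
    by rewrite -(big_mkord xpredT (fun i => f (y i))) nE big_mkord.
  (* A sampled index contributes at most 1 = 7/4 - 3/4, any other at most -3/4; the total is at most
     7m/4 - 3m < 0. *)
  apply: (@le_trans _ _ (\sum_(j < 4 * m) ((j \in codom J)%:R * (7 / 4) - 3 / 4))).
    apply: ler_sum => j _; rewrite /f /= yx; have := big j; rewrite ffunE.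
    have := le_trans (phi1 (x j)) (x1 j); rewrite ler_norml => /andP[_].
    case: (j \in codom J); rewrite /= ?expr0 ?expr1; lra.
  rewrite big_split /= -mulr_suml sumr_const card_ord.
  have : \sum_(j < 4 * m) (j \in codom J)%:R <= m%:R :> R.
    rewrite -natr_sum ler_nat -big_mkcond sum1_card /=.
    by apply: leq_trans (leq_image_card _ _) _; rewrite card_ord.
  move: (\sum_(j < 4 * m) _) => S.
  by rewrite -[_ *+ (4 * m)]mulr_natr natrM; lra.
rewrite ler_normr; apply/orP; right.
by move: emp mean; move: (m%:R^-1 * _) (n.+1%:R^-1 * _) => u v; lra.
Qed.

Lemma nontrivial_type_of_uniform_glivenko_cantelli :
  uniform_glivenko_cantelli (@separably_supported R X) (@dual_unit_ball R X) ->
  nontrivial_type X.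
Proof.
move=> /(_ 2^-1) ugc.
have c0 : (0 < 1 :> \bar R)%E by [].
have [|N _ hN] := ugc _ _ (open_ereal_lt' c0); first by rewrite invr_gt0.
have dev P : separably_supported P ->
    (deviation_prob (@dual_unit_ball R X) P 2^-1 N.+1 < 1)%E.
  move=> sP; apply: le_lt_trans (hN N.+1 (leqnSn N)).
  by apply: ereal_sup_ubound; exists P.
have gap := sign_gap_of_deviation (ltn0Sn N) dev.
have n1 : (1 < 4 * N.+1)%N by rewrite mulnS.
have nR : 1 <= (4 * N.+1)%:R :> R by rewrite ler1n muln_gt0.
have [||theta theta01 hth] := sqr_type_bound_of_gap _ _ gap; first by rewrite muln_gt0.
  move: nR; move: ((4 * N.+1)%:R) => z z1.
  by apply/andP; split; [rewrite invr_gt0|rewrite invf_le1]; lra.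
have [alpha [C [alpha01 C0 bnd]]] := rademacher_mean_power_bound n1 theta01 hth.
exact: has_type_of_power_bound alpha01 C0 bnd.
Qed.

End TypeFromGlivenkoCantelli.

(** * The Glivenko-Cantelli property from type *)

Section Symmetrization.
Context {R : realType} {X : normedModType R}.
Variables (K : nat) (p : 'I_K -> R) (y : 'I_K -> X).
Hypotheses (p0 : forall j, 0 <= p j) (p1 : \sum_j p j = 1).

Fixpoint iid_mean (z : 'I_K -> X) n (phi : X -> R) : R :=
  if n is n'.+1 then \sum_j p j * iid_mean z n' (fun v => phi (v + z j))
  else phi 0.

Lemma iid_meanE z n phi :
  \sum_(J : {ffun 'I_n -> 'I_K}) (\prod_l p (J l)) * phi (\sum_l z (J l)) =
  iid_mean z n phi.
Proof.
elim: n phi => [|n IH] phi /=.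
  have e0 : 'I_0 -> 'I_K by case.
  by rewrite (sum_ffun_ord0 _ [ffun i => e0 i]) !big_ord0 mul1r.
rewrite sum_ffun_ordS; apply: eq_bigr => j _; rewrite -IH mulr_sumr.
apply: eq_bigr => J _; rewrite !big_ord_recl ffcons0 -mulrA; congr (_ * (_ * phi _)).
  by apply: eq_bigr => l _; rewrite ffconsS.
by rewrite addrC; congr (_ + _); apply: eq_bigr => l _; rewrite ffconsS.
Qed.

(** The mean of phi at a sum of vectors 2 y_J with independent signs and independent indices J of
    law [p]. The 2 is the factor lost in symmetrization. *)
Fixpoint symmetric_mean n (phi : X -> R) : R :=
  if n is n'.+1 then
    \sum_j p j * symmetric_mean n'
      (fun v => (phi (v + 2 *: y j) + phi (v - 2 *: y j)) / 2)
  else phi 0.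

Lemma le_symmetric_mean n phi psi : (forall v, phi v <= psi v) ->
  symmetric_mean n phi <= symmetric_mean n psi.
Proof.
elim: n phi psi => [|n IH] phi psi h /=; first exact: h.
by apply: ler_sum => j _; rewrite ler_wpM2l// IH// => v; rewrite ler_pM2r// lerD.
Qed.

Lemma symmetric_mean0 n : symmetric_mean n (fun=> 0) = 0.
Proof.
elim: n => [|n IH] //=; rewrite big1// => j _.
by under [X in symmetric_mean _ X]funext do rewrite addr0 mul0r; rewrite IH mulr0.
Qed.

Lemma symmetric_meanD n phi psi : symmetric_mean n (fun v => phi v + psi v) =
  symmetric_mean n phi + symmetric_mean n psi.
Proof.
elim: n phi psi => [|n IH] phi psi //=; rewrite -big_split; apply: eq_bigr => j _ /=.
rewrite -mulrDr -IH; congr (_ * symmetric_mean n _); apply/funext => v; ring.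
Qed.

Lemma symmetric_meanZ n a phi :
  symmetric_mean n (fun v => a * phi v) = a * symmetric_mean n phi.
Proof.
elim: n phi => [|n IH] phi //=; rewrite mulr_sumr; apply: eq_bigr => j _ /=.
rewrite mulrCA -IH; congr (_ * symmetric_mean n _); apply/funext => v; ring.
Qed.

Lemma symmetric_mean_sum n (I : Type) (r : seq I) (phi : I -> X -> R) :
  symmetric_mean n (fun v => \sum_(i <- r) phi i v) =
  \sum_(i <- r) symmetric_mean n (phi i).
Proof.
elim: r => [|i r IH].
  by under [X in symmetric_mean _ X]funext do rewrite big_nil; rewrite big_nil symmetric_mean0.
by under [X in symmetric_mean _ X]funext do rewrite big_cons; rewrite big_cons symmetric_meanD IH.
Qed.

Let m := \sum_j p j *: y j.

Let weight_pairs (f g : 'I_K -> R) :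
  \sum_j \sum_l p j * (p l * ((f l + g j) / 2)) = \sum_j p j * ((f j + g j) / 2).
Proof.
have E j : \sum_l p j * (p l * ((f l + g j) / 2)) =
    p j * (\sum_l p l * (f l / 2)) + p j * (g j / 2).
  rewrite -mulr_sumr; under eq_bigr do rewrite mulrDl mulrDr.
  by rewrite big_split /= -mulr_suml p1 mul1r mulrDr.
under eq_bigr do rewrite E.
rewrite big_split /= -mulr_suml p1 mul1r -big_split /=.
by apply: eq_bigr => j _; ring.
Qed.

(** Symmetrization one variable at a time. By convexity m - y_j is replaced by the mean over l of
    y_l - y_j, and the norm is split as half of a term in 2 y_l plus half of a term in - 2 y_j. As l
    and j have the same law, [weight_pairs] merges them into one index with a random sign. The shift
    [a] carries the variables already treated. *)
Lemma iid_mean_norm_le n a :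
  iid_mean (fun j => m - y j) n (fun v => `|v + a|) <=
  symmetric_mean n (fun v => `|v + a|).
Proof.
elim: n a => [|n IH] a //=.
apply: (@le_trans _ _ (\sum_j p j * symmetric_mean n (fun v => `|v + (m - y j + a)|))).
  apply: ler_sum => j _; rewrite ler_wpM2l//.
  by under [X in iid_mean _ _ X]funext do rewrite -addrA; exact: IH.
have -> : \sum_j p j * symmetric_mean n (fun v => `|v + (m - y j + a)|) =
    symmetric_mean n (fun v => \sum_j p j * `|v + (m - y j + a)|).
  by rewrite symmetric_mean_sum; apply: eq_bigr => j _; rewrite symmetric_meanZ.
have -> : \sum_j p j * symmetric_mean n
      (fun v => (`|v + 2 *: y j + a| + `|v - 2 *: y j + a|) / 2) =
    symmetric_mean n (fun v => \sum_j p j *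
      ((`|v + 2 *: y j + a| + `|v - 2 *: y j + a|) / 2)).
  by rewrite symmetric_mean_sum; apply: eq_bigr => j _; rewrite symmetric_meanZ.
apply: le_symmetric_mean => v.
apply: (@le_trans _ _ (\sum_j \sum_l p j * (p l *
    ((`|v + 2 *: y l + a| + `|v - 2 *: y j + a|) / 2)))).
  apply: ler_sum => j _; rewrite -mulr_sumr ler_wpM2l//.
  have -> : v + (m - y j + a) = \sum_l p l *: (v + (y l - y j + a)).
    have -> : \sum_l p l *: (v + (y l - y j + a)) =
        \sum_l (p l *: (v - y j + a) + p l *: y l).
      apply: eq_bigr => l _; rewrite -scalerDr; congr (_ *: _).
      by rewrite -!addrA; congr (v + _); rewrite addrC -!addrA; congr (_ + _); rewrite addrC.
    rewrite big_split /= -scaler_suml p1 scale1r -/m -!addrA; congr (v + _).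
    by rewrite addrC -!addrA; congr (_ + _); rewrite addrC.
  apply: le_trans (ler_norm_sum _ _ _) _; apply: ler_sum => l _.
  rewrite normrZ ger0_norm// ler_wpM2l//.
  have -> : v + (y l - y j + a) =
      2^-1 *: ((v + 2 *: y l + a) + (v - 2 *: y j + a)).
    have dbl (u : X) : u + u = 2 *: u by rewrite scaler_nat mulr2n.
    rewrite addrACA (addrACA v) !dbl -scalerBr -!scalerDr scalerA mulVf// scale1r.
    by rewrite addrA.
  by rewrite normrZ gtr0_norm ?invr_gt0// mulrC ler_pM2r ?invr_gt0// ler_normD.
by rewrite weight_pairs.
Qed.

Lemma symmetric_mean_le n phi c :
  (forall us, size us = n -> (forall u, u \in us -> exists j, u = 2 *: y j) ->
    sign_mean us phi <= c) -> symmetric_mean n phi <= c.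
Proof.
elim: n phi => [|n IH] phi h /=; first exact: (h [::]).
apply: (@le_trans _ _ (\sum_j p j * c)); last by rewrite -mulr_suml p1 mul1r.
apply: ler_sum => j _; rewrite ler_wpM2l//.
apply: IH => us usn usy.
rewrite (_ : sign_mean us _ = sign_mean (2 *: y j :: us) phi); last first.
  rewrite /= -sign_meanD mulrC -sign_meanZ.
  by congr sign_mean; apply/funext => v; rewrite mulrC.
apply: h => [|u]; first by rewrite /= usn.
by rewrite inE => /predU1P[->|/usy//]; exists j.
Qed.

Lemma sum_prod_weight n (g : 'I_K -> R) :
  \sum_(J : {ffun 'I_n -> 'I_K}) (\prod_l p (J l)) * (\sum_l g (J l)) =
  n%:R * \sum_j p j * g j.
Proof.
under eq_bigr do rewrite mulr_sumr.
rewrite exchange_big /= -[in RHS](card_ord n) -sumr_const mulr_suml.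
apply: eq_bigr => l _; rewrite mul1r.
transitivity (\sum_(J : {ffun 'I_n -> 'I_K}) \prod_(i < n) (p (J i) * (if i == l then g (J i) else 1))).
  apply: eq_bigr => J _; rewrite big_split /=; congr (_ * _).
  by rewrite (bigD1 l)//= eqxx big1 ?mulr1// => l' /negbTE ->.
rewrite -(bigA_distr_bigA (fun (l' : 'I_n) (j : 'I_K) => p j * (if l' == l then g j else 1))) /=.
rewrite (bigD1 l)//= eqxx [X in _ * X]big1 ?mulr1// => l' /negbTE ->.
by under eq_bigr do rewrite mulr1.
Qed.

Lemma iid_deviation_mean_le q (C : R) n : 0 < q ->
  (forall n (x : 'I_n -> X),
     rademacher_mean x <= C * (\sum_(i < n) `|x i| `^ q) `^ q^-1) ->
  (forall j, `|y j| <= 1) ->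
  \sum_(J : {ffun 'I_n -> 'I_K}) (\prod_l p (J l)) * `|\sum_l (m - y (J l))| <=
  2 * `|C| * n%:R `^ q^-1.
Proof.
move=> q0 tq y1.
rewrite (iid_meanE (fun j => m - y j) _ (fun v => `|v|)).
have -> : (fun v : X => `|v|) = (fun v => `|v + 0|) by apply/funext => v; rewrite addr0.
apply: le_trans (iid_mean_norm_le _ _) _.
apply: symmetric_mean_le => us usn usy.
under [X in sign_mean _ X]funext do rewrite addr0.
pose x (i : 'I_n) := nth 0 us i.
have -> : us = [seq x i | i <- enum 'I_n].
  by rewrite /x (map_comp (nth 0 us) val) val_enum_ord -usn map_nth_iota0 ?take_size.
rewrite -rademacher_meanE; apply: le_trans (tq _ _) _.
have q0' := ltW q0.
apply: (@le_trans _ _ (`|C| * (2 `^ q * n%:R) `^ q^-1)).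
  apply: le_trans (ler_wpM2r (powR_ge0 _ _) (ler_norm C)) _; rewrite ler_wpM2l//.
  have h0 : 0 <= q^-1 by rewrite invr_ge0.
  apply: (ge0_ler_powR h0); rewrite ?nnegrE.
  - by apply: sumr_ge0 => i _; exact: powR_ge0.
  - by rewrite mulr_ge0// powR_ge0.
  rewrite mulr_natr -[X in _ *+ X](card_ord n) -sumr_const; apply: ler_sum => i _.
  apply: (ge0_ler_powR q0'); rewrite ?nnegrE//.
  have xus : x i \in us by rewrite mem_nth// usn.
  by have [j ->] := usy _ xus; rewrite normrZ ger0_norm//; have := y1 j; lra.
by rewrite powRM ?powR_ge0// -powRrM mulfV ?gt_eqF// powRr1// mulrCA mulrA.
Qed.

End Symmetrization.

(** * Finite approximation of a separably supported law *)

Section SeparablePartition.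
Context {R : realType} {X : normedModType R}.
Implicit Types (P : probability (borel_ball X) R).

Lemma measurable_near (v : X) (eta : R) :
  measurable [set x : borel_ball X | `|v - ball_val x| < eta].
Proof.
apply: sub_sigma_algebra.
have cg : continuous (fun x : set_type (@unit_ball R X) => `|v - set_val x|).
  have c1 : continuous (fun x : set_type (@unit_ball R X) => v - set_val x).
    move=> x; apply: continuousB; first exact: cst_continuous.
    exact: (@initial_continuous _ _ (@set_val X (@unit_ball R X))).
  by move=> x; exact: (continuous_comp (c1 x) (@norm_continuous _ _ _)).
move/continuousP : cg => /(_ [set r | r < eta]); apply; exact: open_lt.
Qed.

(** The last cell collects the exceptional points: its mass is small, but its centre need not be
    near them. *)
Definition fine_partition P (eta : R) K (A : 'I_K.+1 -> set (borel_ball X))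
    (y : 'I_K.+1 -> X) : Prop :=
  [/\ forall i, measurable (A i), forall x, exists i, A i x,
      trivIset setT A, forall i, `|y i| <= 1
    & (forall i x, i != ord_max -> A i x -> `|y i - ball_val x| <= eta) /\
      (P (A ord_max) <= eta%:E)%E].

Lemma fine_partition_exists P (eta : R) : separably_supported P -> 0 < eta ->
  exists K A y, @fine_partition P eta K A y.
Proof.
move=> [D [cD PD]] eta0.
have [f injD] := elimT (countable_injP _) cD.
(* The point of [D] with code [k], or the default point if there is none. *)
pose e k : borel_ball X := xget point [set x : borel_ball X | D x /\ f x = k].
have eE x : D x -> e (f x) = x.
  move=> Dx; have := @xgetPex _ point [set z : borel_ball X | D z /\ f z = f x].
  move=> /(_ (ex_intro _ x (conj Dx erefl)))[De fe].
  by apply: injD fe; apply: mem_set.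
pose U k : set (borel_ball X) := [set x | `|ball_val (e k) - ball_val x| < eta].
have mU k : measurable (U k) by exact: measurable_near.
pose V n := \big[setU/set0]_(k < n) U k.
have mV n : measurable (V n) by exact: bigsetU_measurable.
have PU : (P (\bigcup_k U k) = 1)%E.
  apply/eqP; rewrite eq_le probability_le1//=; last exact: bigcup_measurable.
  have mcD : measurable (closure D : set (borel_ball X)).
    rewrite -[X in measurable X]setCK; apply: measurableC.
    by apply: sub_sigma_algebra; apply: closed_openC; exact: closed_closure.
  rewrite -PD; apply: le_measure; rewrite ?inE//; first exact: bigcup_measurable.
  move=> x clx.
  have nx : nbhs (x : set_type (@unit_ball R X))
      [set z : set_type (@unit_ball R X) | `|set_val x - set_val z| < eta].
    have cv := (@initial_continuous _ _ (@set_val X (@unit_ball R X))) x.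
    have h : nbhs (x : set_type (@unit_ball R X)) (set_val @^-1` ball (set_val x) eta).
      exact: (cv _ (nbhsx_ballx (set_val x) eta eta0)).
    by move: h; rewrite -ball_normE.
  have [z [Dz xz]] := clx _ nx.
  by exists (f z) => //; rewrite /U /= eE// distrC.
have [K hK] : exists K, ((1 - eta)%:E < P (V K.+1))%E.
  have lt1 : ((1 - eta)%:E < 1%:E :> \bar R)%E by rewrite lte_fin; lra.
  have mVU : measurable (\bigcup_n V n.+1) by exact: bigcup_measurable.
  have VU : \bigcup_n V n.+1 = \bigcup_k U k := bigcup_bigsetU_bigcup U.
  have h : (P \o (fun n => V n.+1)) @ \oo --> 1%E.
    rewrite -PU -VU; apply: nondecreasing_cvg_mu => //.
    by move=> i j ij; apply/subsetPset; exact: subset_bigsetU.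
  have [N _ /(_ N (leqnn N)) hN] := h _ (open_ereal_gt' lt1).
  by exists N.
pose L := K.+1.
pose A (i : 'I_L.+1) := if (i < L)%N then seqDU U i else ~` V L.
pose y (i : 'I_L.+1) := if (i < L)%N then ball_val (e i) else 0.
have UV k x : (k < L)%N -> U k x -> V L x.
  by move=> kL Ux; rewrite /V -bigcup_mkord; exists k.
exists L, A, y; split.
- move=> i; rewrite /A; case: ifP => _; last exact: measurableC.
  by apply: measurableD => //; exact: bigsetU_measurable.
- move=> x; have [|nVx] := pselect (V L x); last first.
    by exists ord_max; rewrite /A /= ltnn.
  rewrite /V bigsetU_seqDU -bigcup_mkord => -[k /= kL Ux].
  by exists (widen_ord (leqnSn L) (Ordinal kL)); rewrite /A /= kL.
- apply/trivIsetP => i j _ _ ij; rewrite /A.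
  have aux (k : 'I_L.+1) : (k < L)%N -> seqDU U k `&` ~` V L = set0.
    move=> kL; apply/seteqP; split => // x [Ux nVx]; apply: nVx.
    exact: (UV k x kL (@subset_seqDU _ U k x Ux)).
  case: ifP => iL; case: ifP => jL.
  + by have /trivIsetP := @trivIset_seqDU _ U; apply.
  + exact: aux.
  + by rewrite setIC; exact: aux.
  + exfalso; move/eqP: ij; apply; apply/val_inj => /=.
    by move: iL jL (ltn_ord i) (ltn_ord j); rewrite /L; lia.
- by move=> i; rewrite /y; case: ifP => _; rewrite ?normr0// norm_ball_val.
split.
  move=> i x imax; have iL : (i < L)%N.
    by rewrite ltn_neqAle -ltnS ltn_ord andbT; move: imax; rewrite -val_eqE.
  rewrite /A /y iL => Ux; apply: ltW.
  exact: (@subset_seqDU _ U i x Ux).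
rewrite /A /= ltnn probability_setC//.
have fV : P (V L) \is a fin_num by exact: fin_num_measure.
by move: hK; rewrite -(fineK fV) -EFinB lte_fin lee_fin; lra.
Qed.

End SeparablePartition.

Section PartitionMeans.
Context d (T : measurableType d) (R : realType) (P : probability T R).

Lemma bounded_integrable (f : T -> R) (M : R) : measurable_fun setT f ->
  (forall x, `|f x| <= M) -> P.-integrable setT (EFin \o f).
Proof.
move=> mf fM; apply: (@le_integrable _ _ _ P setT measurableT _ (EFin \o cst M)).
- exact/measurable_EFinP.
- by move=> x _ /=; rewrite lee_fin (le_trans (fM x))// ler_norm.
- exact: finite_measure_integrable_cst.
Qed.

Lemma Rintegral_sum_indic K (A : 'I_K -> set T) (c : 'I_K -> R) :
  (forall i, measurable (A i)) ->
  (\int[P]_x (\sum_i c i * \1_(A i) x) = \sum_i c i * fine (P (A i)))%R.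
Proof.
move=> mA; rewrite /Rintegral; under eq_integral do rewrite -sumEFin.
have iA i : P.-integrable setT (EFin \o \1_(A i)) by exact: integrable_indic.
have icA i : P.-integrable setT (fun x => (c i * \1_(A i) x)%:E).
  rewrite (_ : (fun x => (c i * \1_(A i) x)%:E) =
    (fun x => (c i)%:E * (EFin \o \1_(A i)) x)%E)//.
  exact: integrableZl.
rewrite integral_sum//.
rewrite (eq_bigr (fun i => (c i * fine (P (A i)))%:E)); first by rewrite sumEFin.
move=> i _; rewrite EFinM fineK ?fin_num_measure//.
have <- : (\int[P]_x (\1_(A i) x)%:E = P (A i))%E by rewrite integral_indic// setIT.
by rewrite -(integralZl measurableT (iA i)); apply: eq_integral => x _; rewrite EFinM.
Qed.

Lemma trivIset_measure_sum1 K (A : 'I_K -> set T) :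
  (forall i, measurable (A i)) -> (forall x, exists i, A i x) -> trivIset setT A ->
  \sum_i fine (P (A i)) = 1.
Proof.
move=> mA cA tA.
have PT : (P (\big[setU/set0]_(i < K) A i) = 1)%E.
  rewrite (_ : \big[setU/set0]_(i < K) A i = setT) ?probability_setT//.
  apply/seteqP; split => // x _; have [i Aix] := cA x.
  by rewrite (bigD1 i)//=; left.
apply: EFin_inj; rewrite -PT measure_bigsetU_ord// -sumEFin.
by apply: eq_bigr => i _; rewrite fineK// fin_num_measure.
Qed.

Lemma sum_indic_partition K (A : 'I_K -> set T) (c : 'I_K -> R) i x :
  trivIset setT A -> A i x -> \sum_j c j * \1_(A j) x = c i.
Proof.
move=> tA Aix; rewrite (bigD1 i)//= indicE mem_set// mulr1 big1 ?addr0// => j ji.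
rewrite indicE memNset ?mulr0// => Ajx.
by move/eqP: ji; apply; apply: (tA j i) => //; exists x.
Qed.

End PartitionMeans.

Lemma measure_le_bigsetU d (T : measurableType d) (R : realType)
    (Q : {measure set T -> \bar R}) (I : Type) (r : seq I) (p : pred I) (E : I -> set T) :
  (forall i, measurable (E i)) ->
  (Q (\big[setU/set0]_(i <- r | p i) E i) <= \sum_(i <- r | p i) Q (E i))%E.
Proof.
move=> mE; elim: r => [|i r IH]; first by rewrite !big_nil measure0.
rewrite !big_cons; case: ifP => // _.
apply: le_trans (measureU2 _ _ _) _ => //; first exact: bigsetU_measurable.
by rewrite leeD2l.
Qed.

(** * The deviation bound for a law with a fine partition *)

Section DeviationBound.
Context {R : realType} {X : normedModType R}.
Let F := @dual_unit_ball R X.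

Lemma dual_ball_contraction (phi : {linear X -> R^o}) :
  (forall x, `|x| <= 1 -> `|phi x| <= 1) -> forall x, `|phi x| <= `|x|.
Proof.
move=> phi1 x; have [->|x0] := eqVneq x 0; first by rewrite linear0 !normr0.
have nx : 0 < `|x| by rewrite normr_gt0.
have : `|phi (`|x|^-1 *: x)| <= 1.
  by apply: phi1; rewrite normrZ gtr0_norm ?invr_gt0// mulVf// gt_eqF.
rewrite linearZ /= normrM gtr0_norm ?invr_gt0// mulrC ler_pdivrMr// mul1r.
by [].
Qed.

Variables (P : probability (borel_ball X) R) (eta : R) (K : nat).
Variables (A : 'I_K.+1 -> set (borel_ball X)) (y : 'I_K.+1 -> X).
Hypotheses (eta0 : 0 < eta) (hA : fine_partition P eta A y).
Let p i := fine (P (A i)).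
Let m := \sum_i p i *: y i.

Let p0 i : 0 <= p i. Proof. exact: fine_ge0. Qed.

Let p1 : \sum_i p i = 1.
Proof. by case: hA => mA cA tA _ _; exact: trivIset_measure_sum1. Qed.

Let pmax : p ord_max <= eta.
Proof.
case: hA => mA _ _ _ [_ h]; rewrite -lee_fin /p fineK//.
exact: fin_num_measure.
Qed.

Let approx (phi : {linear X -> R^o}) i x : (forall v, `|phi v| <= `|v|) -> A i x ->
  `|phi (y i) - phi (ball_val x)| <= eta + 2 * (i == ord_max)%:R.
Proof.
move=> phi1 Aix; case: hA => _ _ _ y1 [near _]; rewrite -linearB.
have [imax|imax] := eqVneq i ord_max.
  apply: le_trans (phi1 _) _; apply: le_trans (ler_normB _ _) _.
  by have := y1 i; have := norm_ball_val x; rewrite mulr1; have := eta0; lra.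
by rewrite mulr0 addr0; apply: le_trans (phi1 _) _; exact: near.
Qed.

(** Moving each point to the centre of its cell costs [eta] on the good cells and at most 2 more on
    the last one, of mass at most [eta]. *)
Let mean_approx (phi : {linear X -> R^o}) : continuous phi ->
  (forall v, `|phi v| <= `|v|) ->
  `|(\int[P]_x (phi \o @ball_val R X) x)%R - phi m| <= 3 * eta.
Proof.
move=> cphi phi1; case: (hA) => mA cA tA y1 _.
set f := phi \o _.
have mf : measurable_fun setT f.
  by apply: dual_unit_ball_measurable; exact: contraction_in_dual_ball.
have f1 x : `|f x| <= 1.
  by apply: le_trans (phi1 _) _; exact: norm_ball_val.
pose g x := \sum_i phi (y i) * \1_(A i) x.
have mg : measurable_fun setT g.
  by apply: measurable_sum => i; apply: measurable_funM => //; exact: measurable_indic.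
have gE i x : A i x -> g x = phi (y i) by exact: sum_indic_partition.
have g1 x : `|g x| <= 1.
  have [i Aix] := cA x; rewrite (gE _ _ Aix).
  by apply: le_trans (phi1 _) _; exact: y1.
have -> : phi m = (\int[P]_x g x)%R.
  rewrite /g Rintegral_sum_indic// linear_sum; apply: eq_bigr => i _.
  by rewrite linearZ /= mulrC.
have if_ := bounded_integrable P mf f1; have ig := bounded_integrable P mg g1.
rewrite -RintegralB//.
have mB : measurable_fun setT (fun x => f x - g x) by exact: measurable_funB.
have fg2 x : `|f x - g x| <= 2.
  by apply: le_trans (ler_normB _ _) _; have := f1 x; have := g1 x; lra.
have iB := bounded_integrable P mB fg2.
apply: le_trans (le_normr_Rintegral _ iB) _ => //.
have iA : P.-integrable setT (EFin \o \1_(A ord_max)) by exact: integrable_indic.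
have iA2 : P.-integrable setT (EFin \o (fun x => 2 * \1_(A ord_max) x)).
  by rewrite (_ : EFin \o _ = (fun x => 2%:E * (EFin \o \1_(A ord_max)) x)%E)//; exact: integrableZl.
have ic : P.-integrable setT (EFin \o (fun=> eta)) by exact: finite_measure_integrable_cst.
apply: (@le_trans _ _ (\int[P]_x (eta + 2 * \1_(A ord_max) x))%R).
  apply: le_Rintegral => //.
  - have mN : measurable_fun setT (fun x => `|f x - g x|) by exact: measurableT_comp.
    by apply: (bounded_integrable _ mN (M := 2)) => x; rewrite normr_id.
  - rewrite (_ : EFin \o _ = ((EFin \o (fun=> eta)) \+ (EFin \o (fun x => 2 * \1_(A ord_max) x)%R))%E)//.
    exact: integrableD.
  - move=> x _; have [i Aix] := cA x; rewrite (gE _ _ Aix) distrC.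
    apply: le_trans (approx phi1 Aix) _; rewrite lerD2l ler_wpM2l// indicE.
    case: eqP => [ie|_]; last by rewrite ler0n.
    by rewrite mem_set// -ie.
rewrite RintegralD// RintegralZl//.
have -> : (\int[P]_x eta)%R = eta.
  rewrite Rintegral_cst// (_ : fine _ = 1) ?mulr1//.
  exact: (congr1 fine (probability_setT P)).
have -> : (\int[P]_x \1_(A ord_max) x)%R = p ord_max.
  by rewrite /Rintegral integral_indic// setIT.
by have := pmax; lra.
Qed.

(** Up to 4 eta, this bounds the deviation of all functionals for every sample falling in the cells
    J: 3 eta come from the mean, [eta] from the sample, and each visit to the last cell costs
    another 2 / n. *)
Let Psi n (J : {ffun 'I_n -> 'I_K.+1}) : R :=
  n%:R^-1 * (`|\sum_l (m - y (J l))| + 2 * \sum_l (J l == ord_max)%:R).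

Let deviation_le n (J : {ffun 'I_n -> 'I_K.+1}) (u : 'I_n -> borel_ball X) f :
  (0 < n)%N -> F f -> (forall l, A (J l) (u l)) ->
  `|(\int[P]_x f x)%R - n%:R^-1 * \sum_l f (u l)| <= 4 * eta + Psi J.
Proof.
move=> n0 [phi [cphi phiB ->]] Au.
have phi1 := dual_ball_contraction phiB.
have nR : n%:R != 0 :> R by rewrite pnatr_eq0 -lt0n.
have ni : 0 <= n%:R^-1 :> R by rewrite invr_ge0.
set I1 := (\int[P]_x _ x)%R; set S := \sum_l _ (u l).
have -> : I1 - n%:R^-1 * S = (I1 - phi m) +
    n%:R^-1 * (phi (\sum_l (m - y (J l))) + \sum_l (phi (y (J l)) - phi (ball_val (u l)))).
  have phiE : phi (\sum_l (m - y (J l))) = \sum_l (phi m - phi (y (J l))).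
    by rewrite linear_sum; apply: eq_bigr => l _; rewrite linearB.
  rewrite phiE -big_split /= (eq_bigr (fun l => phi m - phi (ball_val (u l)))); last first.
    by move=> l _; rewrite addrA subrK.
  rewrite sumrB sumr_const card_ord -[X in n%:R^-1 * (X - _)]mulr_natl mulrBr mulKf//.
  by rewrite addrA subrK.
apply: le_trans (ler_normD _ _) _.
have h1 := mean_approx cphi phi1; rewrite -/I1 in h1.
rewrite normrM (ger0_norm ni).
have h2 : `|phi (\sum_l (m - y (J l))) + \sum_l (phi (y (J l)) - phi (ball_val (u l)))| <=
    `|\sum_l (m - y (J l))| + (n%:R * eta + 2 * \sum_l (J l == ord_max)%:R).
  apply: le_trans (ler_normD _ _) _; apply: lerD; first exact: phi1.
  apply: le_trans (ler_norm_sum _ _ _) _.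
  apply: (@le_trans _ _ (\sum_l (eta + 2 * (J l == ord_max)%:R))).
    by apply: ler_sum => l _; exact: approx.
  by rewrite big_split /= sumr_const card_ord -mulr_sumr -(mulr_natl eta).
have h3 := ler_wpM2l ni h2.
apply: le_trans (lerD h1 h3) _.
rewrite /Psi; set a := `|_|; set b := \sum_l _.
have -> : n%:R^-1 * (a + (n%:R * eta + 2 * b)) = eta + n%:R^-1 * (a + 2 * b).
  by move: nR; move: (n%:R) => z z0; field.
lra.
Qed.

(** Since 4 eta <= eps / 2, the deviation event lies in the finite union [W] of the product cells
    with Psi >= eps / 2. This set is measurable, and Markov's inequality for it is a finite sum
    weighted by the masses of the cells. The bound does not involve the number of cells. *)
Lemma deviation_prob_le q (C eps : R) n : (0 < n)%N -> 0 < q ->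
  (forall n (x : 'I_n -> X),
     rademacher_mean x <= C * (\sum_(i < n) `|x i| `^ q) `^ q^-1) ->
  8 * eta <= eps ->
  (deviation_prob F P eps n <=
   ((2 / eps) * (n%:R^-1 * (2 * `|C| * n%:R `^ q^-1) + 2 * eta))%:E)%E.
Proof.
move=> n0 q0 tq epseta; case: (hA) => mA cA tA y1 _.
have eps0 : 0 < eps by have := eta0; lra.
have nR : n%:R != 0 :> R by rewrite pnatr_eq0 -lt0n.
apply: ge_ereal_sup => _ [d' [S [Q [Xs [[Xlaw Xind] ->]]]]].
pose E (J : {ffun 'I_n -> 'I_K.+1}) := \bigcap_(l in [set: 'I_n]) (Xs l @^-1` A (J l)).
have mE J : measurable (E J).
  apply: fin_bigcap_measurable => // l _.
  by rewrite -[X in measurable X]setTI; exact: measurable_funPT.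
have QE J : Q (E J) = (\prod_l p (J l))%:E.
  rewrite Xind => [|l]; last exact: mA.
  rewrite -prodEFin; apply: eq_bigr => l _.
  have := Xlaw l (A (J l)) (mA _); rewrite /distribution /pushforward => ->.
  by rewrite /p fineK// fin_num_measure.
pose W := \big[setU/set0]_(J : {ffun 'I_n -> 'I_K.+1} | eps / 2 <= Psi J) E J.
apply: (@le_trans _ _ (mu_ext Q W)).
  apply: le_mu_ext => w /= hw.
  have /choice[J0 hJ0] : forall l, exists i, A i (Xs l w) by move=> l; exact: cA.
  pose J : {ffun 'I_n -> 'I_K.+1} := [ffun l => J0 l].
  have AJ l : A (J l) (Xs l w) by rewrite ffunE.
  have PsiJ : eps / 2 <= Psi J.
    have : (eps%:E <= (4 * eta + Psi J)%:E)%E.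
      apply: le_trans hw _; apply: ge_ereal_sup => _ [f Ff <-].
      by rewrite lee_fin; exact: deviation_le.
    by rewrite lee_fin; lra.
  by rewrite /W (bigD1 J)//=; left => l _; exact: AJ.
rewrite measurable_mu_extE; last exact: bigsetU_measurable.
apply: le_trans (measure_le_bigsetU _ _ _ mE) _.
rewrite (eq_bigr (fun J : {ffun 'I_n -> 'I_K.+1} => (\prod_l p (J l))%:E)); last first.
  by move=> J _; exact: QE.
rewrite sumEFin lee_fin.
have e20 : 0 <= 2 / eps by rewrite divr_ge0// ltW.
have w0 (J : {ffun 'I_n -> 'I_K.+1}) : 0 <= \prod_l p (J l) by exact: prodr_ge0.
have Psi0 (J : {ffun 'I_n -> 'I_K.+1}) : 0 <= Psi J.
  by rewrite /Psi mulr_ge0 ?invr_ge0// addr_ge0// mulr_ge0// sumr_ge0.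
apply: (@le_trans _ _ (\sum_(J : {ffun 'I_n -> 'I_K.+1}) (2 / eps) * ((\prod_l p (J l)) * Psi J))).
  rewrite big_mkcond; apply: ler_sum => J _; case: ifP => [h|_]; last first.
    by apply: mulr_ge0 => //; exact: mulr_ge0.
  rewrite mulrCA ler_peMr// mulrC -ler_pdivrMr ?divr_gt0// mul1r invf_div.
  exact: h.
rewrite -mulr_sumr; apply: ler_wpM2l => //.
have -> : \sum_(J : {ffun 'I_n -> 'I_K.+1}) (\prod_l p (J l)) * Psi J =
    n%:R^-1 * \sum_(J : {ffun 'I_n -> 'I_K.+1}) (\prod_l p (J l)) * `|\sum_l (m - y (J l))| +
    2 * n%:R^-1 * \sum_(J : {ffun 'I_n -> 'I_K.+1}) (\prod_l p (J l)) * \sum_l (J l == ord_max)%:R.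
  rewrite !mulr_sumr -big_split /=; apply: eq_bigr => J _; rewrite /Psi; ring.
apply: lerD.
  by rewrite ler_wpM2l ?invr_ge0//; exact: iid_deviation_mean_le.
rewrite (sum_prod_weight p1 n (fun j => (j == ord_max)%:R)).
rewrite -mulrA ler_wpM2l// mulKf//.
rewrite (bigD1 ord_max)//= eqxx mulr1 big1 ?addr0// => j /negbTE ->.
by rewrite mulr0.
Qed.

End DeviationBound.

Section GlivenkoCantelliFromType.
Context {R : realType} {X : completeNormedModType R}.

(** Suprema in the extended reals may be negative; a point mass and an actual sample of it give the
    lower half of the final squeeze. *)
Lemma deviation_prob_dirac_ge0 (eps : R) n :
  exists2 P, separably_supported P &
    (0 <= deviation_prob (@dual_unit_ball R X) P eps n)%E.
Proof.
pose y (i : nat) : borel_ball X := point.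
exists (@uniform_points _ (borel_ball X) R 0 y).
  pose z : set_type (@unit_ball R X) := (point : borel_ball X).
  exists [set z]; split; first exact: countable1.
  have mem0 : closure [set z] z by exact: subset_closure.
  apply: etrans (uniform_pointsE _ _ _ _) _.
  by rewrite big_ord1 indicE mem_set// invr1 mul1r.
have [Q [Xs [iid _]]] := @uniform_points_sample _ (borel_ball X) R 0 n y.
apply: (@le_trans _ _ (mu_ext Q [set w | (eps%:E <= empirical_deviation
    (@dual_unit_ball R X) (@uniform_points _ (borel_ball X) R 0 y) Xs w)%E])).
  exact: mu_ext_ge0.
by apply: ereal_sup_ubound; exists _, nat, Q, Xs.
Qed.

Lemma cvg_harmonic_powR (a : R) : 0 < a -> (fun n => (harmonic n : R) `^ a) @ \oo --> (0 : R).
Proof.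
move=> a0; apply/cvgr0Pnorm_lt => e e0.
have d0 : 0 < e `^ a^-1 by exact: powR_gt0.
have /cvgr0Pnorm_lt/(_ _ d0) := @cvg_harmonic R.
apply: filterS => n; rewrite !ger0_norm ?powR_ge0 ?harmonic_ge0// => h.
have -> : e = (e `^ a^-1) `^ a by rewrite -powRrM mulVf ?gt_eqF// powRr1// ltW.
by apply: gt0_ltr_powR; rewrite ?nnegrE ?harmonic_ge0 ?powR_ge0.
Qed.

Lemma uniform_glivenko_cantelli_of_nontrivial_type : nontrivial_type X ->
  uniform_glivenko_cantelli (@separably_supported R X) (@dual_unit_ball R X).
Proof.
move=> /ereal_sup_gt[_ [p [p0 [C tC]] <-]]; rewrite lte_fin => p1 eps eps0.
set u := (X in X @ \oo --> _).
pose a := 1 - p^-1.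
have a0 : 0 < a by rewrite subr_gt0 invf_lt1.
pose b n : R := (2 / eps) * (2 * `|C| * (harmonic n) `^ a + 2 * harmonic n).
have ub n : (u n.+1 <= (b n)%:E)%E.
  apply: ge_ereal_sup => _ [P sP <-].
  (* The partition may depend on n and on the law, as only [eta] enters the bound; a harmonic [eta]
     makes its contribution vanish uniformly. *)
  pose eta := Num.min (eps / 8) (harmonic n).
  have eta0 : 0 < eta by rewrite lt_min divr_gt0//= harmonic_gt0.
  have [K [A [y hA]]] := fine_partition_exists sP eta0.
  have h8 : 8 * eta <= eps.
    have : eta <= eps / 8 by rewrite ge_min lexx.
    by lra.
  apply: le_trans (deviation_prob_le eta0 hA (ltn0Sn n) p0 tC h8) _.
  rewrite lee_fin /b ler_wpM2l ?divr_ge0 ?(ltW eps0)//; apply: lerD.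
    have -> : harmonic n `^ a = n.+1%:R^-1 * n.+1%:R `^ p^-1 :> R.
      rewrite /harmonic /= -(powR_inv1 (ler0n R n.+1)) -powRrM -powRD.
        by congr (_ `^ _); rewrite /a; ring.
      by apply/implyP => _; rewrite pnatr_eq0.
    by rewrite mulrCA.
  by rewrite ler_wpM2l// ge_min lexx orbT.
have lb n : (0 <= u n)%E.
  have [P sP h] := deviation_prob_dirac_ge0 eps n.
  by apply: le_trans h _; apply: ereal_sup_ubound; exists P.
rewrite -(cvg_shiftS u).
have cb : (fun n => (b n)%:E) @ \oo --> 0%E.
  apply: cvg_EFin; first by apply: nearW.
  have -> : fine \o (fun n => (b n)%:E) = b by [].
  have -> : (0 : R) = (2 / eps) * (2 * `|C| * 0 + 2 * 0) by rewrite !mulr0 addr0 mulr0.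
  apply: cvgM; first exact: cvg_cst.
  apply: cvgD; apply: cvgM; try exact: cvg_cst; last exact: cvg_harmonic.
  exact: cvg_harmonic_powR.
have near_b : \forall n \near \oo, (cst 0%E n <= u n.+1 <= (b n)%:E)%E.
  by apply: nearW => n; rewrite /= lb ub.
have := @squeeze_cvge _ _ _ _ _ _ _ near_b _ (cvg_cst _) cb.
exact.
Qed.

End GlivenkoCantelliFromType.

Theorem corollary3p5 (R : realType) (X : completeNormedModType R)
    (infX : infinite_dimensional X) :
  (uniform_glivenko_cantelli (@separably_supported R X) (@dual_unit_ball R X)
     <-> nontrivial_type X)
  /\ ~ uniform_donsker (@dual_unit_ball R X).
Proof.
split; last exact: dual_ball_not_donsker.
split; first exact: nontrivial_type_of_uniform_glivenko_cantelli.
exact: uniform_glivenko_cantelli_of_nontrivial_type.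
Qed.
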